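(* Assume that $F$ satisfies (A1), (A2) and (A3) of the context. Let $x$ be a local solution of problem $(P)$, i.e. $x\in\mathfrak{A}$ and there is $\varepsilon>0$ such that $J(x)\le J(y)$ for all $y\in\mathfrak{A}$ with $\Vert y-x\Vert_{\mathfrak{X}}<\varepsilon$. Then the function $$q:[0,T]\to\mathbb{R}^{n*},\qquad q(t):=D_3F(t,x_t,x'(t))-\int_t^{\min\{t+r,T\}}\mathcal{R}_n\big(D_2F(s,x_s,x'(s))\big)(t-s)\,ds$$ is of class $C^1$ on $[0,T]$, and for all $t\in[0,T]$ $$\frac{d}{dt}\left[D_3F(t,x_t,x'(t))-\int_t^{\min\{t+r,T\}}\mathcal{R}_n\big(D_2F(s,x_s,x'(s))\big)(t-s)\,ds\right]=\mathcal{R}_n\big(D_2F(t,x_t,x'(t))\big)(0).$$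
   Context: Let $n\ge 1$ be an integer, $0<r<T<+\infty$, $\psi\in C^0([-r,0],\mathbb{R}^n)$, $\zeta\in\mathbb{R}^n$, and $F:[0,T]\times C^0([-r,0],\mathbb{R}^n)\times\mathbb{R}^n\to\mathbb{R}$. Spaces of continuous functions on compact intervals carry the supremum norm; $X^*$ is the topological dual of a normed space $X$ with the operator norm; $\mathbb{R}^{n*}$ is the dual of $\mathbb{R}^n$, with basis $(e_k^* )$ dual to the canonical basis $(e_k)$. For $x\in C^0([-r,T],\mathbb{R}^n)$ and $t\in[0,T]$, $x_t\in C^0([-r,0],\mathbb{R}^n)$ is defined by $x_t(\theta):=x(t+\theta)$. Let $\mathfrak{X}:=\{x\in C^0([-r,T],\mathbb{R}^n): x|_{[0,T]}\in C^1([0,T],\mathbb{R}^n)\}$ with norm $\Vert x\Vert_{\mathfrak{X}}:=\sup_{-r\le t\le T}\Vert x(t)\Vert+\sup_{0\le t\le T}\Vert x'(t)\Vert$; here $x'$ denotes the derivative of $x|_{[0,T]}$ (one-sided at the endpoints $0$ and $T$). Let $\mathfrak{A}:=\{x\in\mathfrak{X}: x_0=\psi,\ x(T)=\zeta\}$. Problem $(P)$ is to minimize $J(x):=\int_0^T F(t,x_t,x'(t))\,dt$ over $x\in\mathfrak{A}$. Assumptions: (A1) $F$ is continuous on $[0,T]\times C^0([-r,0],\mathbb{R}^n)\times\mathbb{R}^n$. (A2) For all $(t,\phi,v)$ the partial Fréchet differential $D_2F(t,\phi,v)\in C^0([-r,0],\mathbb{R}^n)^*$ with respect to the second (function) variable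 exists, and $D_2F$ is continuous from $[0,T]\times C^0([-r,0],\mathbb{R}^n)\times\mathbb{R}^n$ into $C^0([-r,0],\mathbb{R}^n)^*$. (A3) For all $(t,\phi,v)$ the partial Fréchet differential $D_3F(t,\phi,v)\in\mathbb{R}^{n*}$ with respect to the third (vector) variable exists, and $D_3F$ is continuous from $[0,T]\times C^0([-r,0],\mathbb{R}^n)\times\mathbb{R}^n$ into $\mathbb{R}^{n*}$. The operator $\mathcal{R}_n$: for a finite-dimensional normed space $E$, $NBV([-r,0],E)$ is the space of bounded variation functions $g:[-r,0]\to E$ that are left-continuous on $[-r,0)$ and satisfy $g(-r)=0$, with norm the total variation $V_{-r}^0(g)$. For $\gamma\in NBV([-r,0],\mathbb{R})$, $\mu[\gamma]$ is the unique signed Borel measure on $[-r,0]$ with $\mu[\gamma]([\alpha,\beta))=\gamma(\beta)-\gamma(\alpha)$ for $-r\le\alpha<\beta<0$ and $\mu[\gamma]([\alpha,0])=\gamma(0)-\gamma(\alpha)$ for $-r\le\alpha<0$; $\int_{-r}^0 d\gamma(\theta)f(\theta):=\int_{[-r,0]}f\,d\mu[\gamma]$. By the Riesz representation theorem, $\mathcal{R}_1:C^0([-r,0],\mathbb{R})^*\to NBV([-r,0],\mathbb{R})$ is the isometric linear isomorphism with $\langle\ell,\varphi\rangle=\int_{-r}^0 d\mathcal{R}_1(\ell)(\theta)\varphi(\theta)$ for all $\varphi$. For $L\in C^0([-r,0],\mathbb{R}^n)^*$ put $\langle\ell_k,\varphi\rangle:=\langle L,\varphi e_k\rangle$ for $\varphi\in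 C^0([-r,0],\mathbb{R})$, $1\le k\le n$, and $\mathcal{R}_n(L):=\sum_{k=1}^n\mathcal{R}_1(\ell_k)e_k^*\in NBV([-r,0],\mathbb{R}^{n*})$. *)

(* Defs.v *)
From HB Require Import structures.
From mathcomp Require Import all_boot all_order all_algebra.
From mathcomp Require Import all_classical all_reals all_analysis.

Set Implicit Arguments.
Unset Strict Implicit.
Unset Printing Implicit Defensive.
Import Order.TTheory GRing.Theory Num.Theory.
Import numFieldNormedType.Exports.

Local Open Scope classical_set_scope.
Local Open Scope ring_scope.

(* A continuous function on [a, b] is encoded by its extension by zero to R, so
   that Leibniz equality is equality of functions on [a, b]. *)
Definition C0_pred {R : realType} (a b : R) (E : normedModType R) :
    pred (R -> E) :=
  fun f => `[< {within `[a, b], continuous f} /\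
               (forall t, t \notin `[a, b] -> f t = 0) >].

Record C0 {R : realType} (a b : R) (E : normedModType R) : Type := MkC0 {
  C0_fun :> R -> E ;
  C0_funP : C0_fun \in @C0_pred R a b E
}.

Section C0_normed_module.
Context {R : realType} (a b : R) (E : normedModType R).

Lemma C0_submod_closed : submod_closed (@C0_pred R a b E).
Proof.
split.
- apply/asboolP; split => // x.
  exact: (@cst_continuous (subspace `[a, b]) E 0).
- move=> k f g; move=> /asboolP[cf f0] /asboolP[cg g0].
  apply/asboolP; split=> [x|t tab].
    have ckf : {for x, continuous (fun y : subspace `[a, b] => k *: f y)}.
      exact: (@continuousZr _ E (subspace `[a, b]) f k x (cf x)).
    exact: (@continuousD _ E (subspace `[a, b]) _ _ x ckf (cg x)).
  by rewrite !fctE f0// g0// scaler0 addr0.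
Qed.

HB.instance Definition _ :=
  GRing.isSubmodClosed.Build R (R -> E) (@C0_pred R a b E) C0_submod_closed.
HB.instance Definition _ := [isSub for @C0_fun R a b E].
HB.instance Definition _ := [Choice of C0 a b E by <:].
HB.instance Definition _ := [SubChoice_isSubLmodule of C0 a b E by <:].

Lemma C0_within_continuous (f : C0 a b E) : {within `[a, b], continuous f}.
Proof. by have /asboolP := C0_funP f; case. Qed.

Lemma C0_out (f : C0 a b E) t : t \notin `[a, b] -> f t = 0.
Proof. by have /asboolP := C0_funP f; move=> [_]; exact. Qed.

Lemma C0P (f g : C0 a b E) : (forall t, t \in `[a, b] -> f t = g t) -> f = g.
Proof.
move=> fg; apply: val_inj; apply/funext => t.
by have [tab|tab] := boolP (t \in `[a, b]); [exact: fg|rewrite /= !C0_out].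
Qed.

Lemma C0D (f g : C0 a b E) t : (f + g) t = f t + g t.
Proof. by []. Qed.

Lemma C0Z k (f : C0 a b E) t : (k *: f) t = k *: f t.
Proof. by []. Qed.

Lemma C00 t : (0 : C0 a b E) t = 0.
Proof. by []. Qed.

Definition C0_norm (f : C0 a b E) : R := sup [set `|f t| | t in `[a, b]].

Lemma C0_norm_has_ubound (f : C0 a b E) :
  has_ubound [set `|f t| | t in `[a, b]].
Proof.
have /compact_bounded[M [_ Mf]] :=
  continuous_compact (@C0_within_continuous f) (@segment_compact _ a b).
exists (M + 1) => _ [t tab <-].
by apply: (Mf (M + 1)); [rewrite ltrDl|exists t].
Qed.

Lemma C0_norm_ub (f : C0 a b E) t : t \in `[a, b] -> `|f t| <= C0_norm f.
Proof. by move=> tab; apply: (ub_le_sup (C0_norm_has_ubound f)); exists t. Qed.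

Lemma C0_norm_ge0 (f : C0 a b E) : 0 <= C0_norm f.
Proof.
rewrite /C0_norm; have [->|/set0P[_ [t tab _]]] :=
  eqVneq [set `|f t| | t in `[a, b]] set0; first by rewrite sup0.
exact: le_trans (normr_ge0 (f t)) (C0_norm_ub f tab).
Qed.

Lemma C0_norm_le (f : C0 a b E) M :
  0 <= M -> (forall t, t \in `[a, b] -> `|f t| <= M) -> C0_norm f <= M.
Proof.
move=> M0 fM; rewrite /C0_norm.
have [->|/set0P S0] := eqVneq [set `|f t| | t in `[a, b]] set0.
  by rewrite sup0.
by apply: ge_sup => // _ [t tab <-]; exact: fM.
Qed.

Lemma C0_normD (f g : C0 a b E) : C0_norm (f + g) <= C0_norm f + C0_norm g.
Proof.
apply: C0_norm_le => [|t tab]; first by rewrite addr_ge0 ?C0_norm_ge0.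
by rewrite C0D (le_trans (ler_normD _ _))// lerD ?C0_norm_ub.
Qed.

Lemma C0_normZ (k : R) (f : C0 a b E) : C0_norm (k *: f) = `|k| * C0_norm f.
Proof.
have le c (h : C0 a b E) : C0_norm (c *: h) <= `|c| * C0_norm h.
  apply: C0_norm_le => [|t tab]; first by rewrite mulr_ge0 ?C0_norm_ge0.
  by rewrite C0Z normrZ ler_wpM2l ?C0_norm_ub.
apply/eqP; rewrite eq_le le/=.
have [->|k0] := eqVneq k 0; first by rewrite normr0 mul0r C0_norm_ge0.
rewrite -ler_pdivlMl ?normr_gt0// -normfV.
by have := le k^-1 (k *: f); rewrite scalerA mulVf// scale1r.
Qed.

Lemma C0_norm0_eq0 (f : C0 a b E) : C0_norm f = 0 -> f = 0.
Proof.
move=> f0; apply: C0P => t tab; apply/eqP.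
by rewrite C00 -normr_le0 -f0 C0_norm_ub.
Qed.

HB.instance Definition _ := @Lmodule_isNormed.Build R (C0 a b E)
  C0_norm C0_normD C0_normZ C0_norm0_eq0.

End C0_normed_module.

(* The element of C^0([a, b], E) given by the restriction of f to [a, b]; it is
   0 by convention when f is not continuous on [a, b]. *)
Definition toC0 {R : realType} (a b : R) {E : normedModType R} (f : R -> E) :
    C0 a b E :=
  insubd (0 : C0 a b E) (fun t => if t \in `[a, b] then f t else 0).

Lemma toC0E {R : realType} (a b : R) (E : normedModType R) (f : R -> E) t :
  {within `[a, b], continuous f} -> t \in `[a, b] -> toC0 a b f t = f t.
Proof.
move=> cf tab; pose g s := if s \in `[a, b] then f s else 0.
have gP : g \in @C0_pred R a b E.
  apply/asboolP; split=> [|s /negbTE sab]; last by rewrite /g sab.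
  apply: subspace_eq_continuous cf => s; rewrite /from_subspace inE/= => sab.
  by rewrite /g sab.
have -> : toC0 a b f = g :> (R -> E) := insubdK (0 : C0 a b E) gP.
by rewrite /g tab.
Qed.

Definition dual_pred {R : realType} (V : normedModType R) : pred (V -> R) :=
  fun L => `[< linear (L : V -> R^o) /\ continuous L >].

Record dual {R : realType} (V : normedModType R) : Type := MkDual {
  dual_fun :> V -> R ;
  dual_funP : dual_fun \in @dual_pred R V
}.

Section dual_normed_module.
Context {R : realType} (V : normedModType R).

Lemma dual_submod_closed : submod_closed (@dual_pred R V : pred (V -> R^o)).
Proof.
split.
- apply/asboolP; split=> [k u v|x].
    by rewrite /= (_ : k *: 0 + 0 = 0 :> R^o)// scaler0 addr0.
  exact: cst_continuous.
- move=> k f g; move=> /asboolP[lf cf] /asboolP[lg cg].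
  apply/asboolP; split=> [c u v|x].
    rewrite !fctE lf lg !scalerDr !scalerA (mulrC k c) -!addrA; congr (_ + _).
    by rewrite addrCA.
  have ckf : {for x, continuous (fun y => k *: f y)}.
    exact: (@continuousZr _ _ V f k x (cf x)).
  exact: (@continuousD _ _ V _ _ x ckf (cg x)).
Qed.

HB.instance Definition _ := GRing.isSubmodClosed.Build R (V -> R^o)
  (@dual_pred R V) dual_submod_closed.
HB.instance Definition _ := [isSub of dual V for @dual_fun R V : dual V -> V -> R^o].
HB.instance Definition _ := [Choice of dual V by <:].
HB.instance Definition _ := [SubChoice_isSubLmodule of dual V by <:].

Lemma dual_linear (L : dual V) : linear (L : V -> R^o).
Proof. by have /asboolP[] := dual_funP L. Qed.

Lemma dual_continuous (L : dual V) : continuous L.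
Proof. by have /asboolP[] := dual_funP L. Qed.

Lemma dualP (L M : dual V) : L =1 M -> L = M.
Proof. by move=> LM; apply: val_inj; apply/funext. Qed.

Lemma dualD (L M : dual V) v : (L + M) v = L v + M v.
Proof. by []. Qed.

Lemma dualZ k (L : dual V) v : (k *: L) v = k * L v.
Proof. by []. Qed.

Lemma dual0 v : (0 : dual V) v = 0.
Proof. by []. Qed.

Lemma dual_argZ (L : dual V) k v : L (k *: v) = k * L v.
Proof.
have L0 : L 0 = 0.
  have := dual_linear L (-1) 0 0.
  by rewrite scaler0 addr0 scaleN1r addNr.
by have := dual_linear L k v 0; rewrite !addr0 L0 addr0.
Qed.

Definition dual_norm (L : dual V) : R :=
  sup [set `|L v| | v in [set v : V | `|v| <= 1]].

Lemma dual_norm_has_ubound (L : dual V) :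
  has_ubound [set `|L v| | v in [set v : V | `|v| <= 1]].
Proof.
pose l : V -> R^o := L.
pose lM := GRing.isLinear.Build R V R^o *:%R l (@dual_linear L).
pose ll : {linear V -> R^o} := HB.pack l lM.
have /linear_boundedP/pinfty_ex_gt0[M M0 ML] : bounded_near ll (nbhs (0 : V)).
  by apply: continuous_linear_bounded; exact: (@dual_continuous L).
exists M => _ [v /= v1 <-].
by rewrite (le_trans (ML v))// ler_piMr// ltW.
Qed.

Lemma dual_norm_ge0 (L : dual V) : 0 <= dual_norm L.
Proof.
apply: (le_trans (normr_ge0 (L 0))).
apply: (ub_le_sup (dual_norm_has_ubound L)); exists 0 => //=.
by rewrite normr0.
Qed.

Lemma dual_norm_le (L : dual V) M :
  (forall v, `|v| <= 1 -> `|L v| <= M) -> dual_norm L <= M.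
Proof.
move=> LM; apply: ge_sup => [|_ [v v1 <-]]; last exact: LM.
by exists `|L 0|, 0 => //=; rewrite normr0.
Qed.

Lemma dual_norm_ub (L : dual V) v : `|L v| <= dual_norm L * `|v|.
Proof.
have [->|v0] := eqVneq v 0.
  by rewrite -[X in L X](scale0r (0 : V)) dual_argZ mul0r !normr0 mulr0.
have nv0 : 0 < `|v| by rewrite normr_gt0.
rewrite -ler_pdivrMr//.
have -> : `|L v| / `|v| = `|L (`|v|^-1 *: v)|.
  by rewrite dual_argZ normrM normfV normr_id mulrC.
apply: (ub_le_sup (dual_norm_has_ubound L)); exists (`|v|^-1 *: v) => //=.
by rewrite normrZ normfV normr_id mulVf// gt_eqF.
Qed.

Lemma dual_normD (L M : dual V) : dual_norm (L + M) <= dual_norm L + dual_norm M.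
Proof.
apply: dual_norm_le => v v1; rewrite dualD (le_trans (ler_normD _ _))//.
by rewrite lerD// (le_trans (dual_norm_ub _ _))// ler_piMr// dual_norm_ge0.
Qed.

Lemma dual_normZ (k : R) (L : dual V) : dual_norm (k *: L) = `|k| * dual_norm L.
Proof.
have le c (M : dual V) : dual_norm (c *: M) <= `|c| * dual_norm M.
  apply: dual_norm_le => v v1; rewrite dualZ normrM ler_wpM2l//.
  by rewrite (le_trans (dual_norm_ub _ _))// ler_piMr// dual_norm_ge0.
apply/eqP; rewrite eq_le le/=.
have [->|k0] := eqVneq k 0; first by rewrite normr0 mul0r dual_norm_ge0.
rewrite -ler_pdivlMl ?normr_gt0// -normfV.
by have := le k^-1 (k *: L); rewrite scalerA mulVf// scale1r.
Qed.

Lemma dual_norm0_eq0 (L : dual V) : dual_norm L = 0 -> L = 0.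
Proof.
move=> L0; apply: dualP => v; apply/eqP.
by rewrite dual0 -normr_le0 (le_trans (dual_norm_ub L v))// L0 mul0r.
Qed.

HB.instance Definition _ := @Lmodule_isNormed.Build R (dual V)
  dual_norm dual_normD dual_normZ dual_norm0_eq0.

End dual_normed_module.

(* The functional f as an element of the dual; 0 by convention when f is not
   linear and continuous. *)
Definition toDual {R : realType} {V : normedModType R} (f : V -> R) : dual V :=
  insubd (0 : dual V) (f : V -> R^o).

Lemma toDualE {R : realType} (V : normedModType R) (f : V -> R) :
  linear (f : V -> R^o) -> continuous f -> toDual f = f :> (V -> R).
Proof.
move=> lf cf; have fP : (f : V -> R^o) \in @dual_pred R V by exact/asboolP.
exact: (insubdK (0 : dual V) fP).
Qed.

Section calculus_on_a_segment.
Context {R : realType} {V : normedModType R} (a b : R).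
Implicit Type f : R -> V.

(* The filter forces s to stay in [a, b], so that the derivative is one-sided
   at the endpoints. *)
Definition diff_quotient_on f (t : R) :=
  (s - t)^-1 *: (f s - f t) @[s --> within `[a, b] t^'].

Definition derivable_on f (t : R) : Prop := cvg (diff_quotient_on f t).

Definition deriv_on f (t : R) : V := lim (diff_quotient_on f t).

Definition C1_on f : Prop :=
  (forall t, t \in `[a, b] -> derivable_on f t) /\
  {within `[a, b], continuous (deriv_on f)}.

End calculus_on_a_segment.

Section NBV.
Context {R : realType} (r : R).

(* As for C0, functions on [-r, 0] are extended by zero. *)
Definition NBV : set (R -> R) := [set g |
  [/\ bounded_variation (- r) 0 g,
      (forall t, t \in `]- r, 0[ -> g s @[s --> t^'-] --> g t),
      g (- r) = 0 &
      forall t, t \notin `[- r, 0] -> g t = 0]].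

(* Signed Borel measures on [-r, 0] are the charges on R that vanish outside
   [-r, 0]. *)
Definition is_charge_of (g : R -> R)
    (mu : {charge set (measurableTypeR R) -> \bar R}) : Prop :=
  [/\ (forall A : set (measurableTypeR R), measurable A ->
         A `&` `[- r, 0] = set0 -> mu A = 0%E),
      (forall alpha beta, - r <= alpha -> alpha < beta -> beta < 0 ->
         mu `[alpha, beta[%classic = (g beta - g alpha)%:E) &
      (forall alpha, - r <= alpha -> alpha < 0 ->
         mu `[alpha, 0]%classic = (g 0 - g alpha)%:E)].

Definition charge_of (g : R -> R) :
    {charge set (measurableTypeR R) -> \bar R} :=
  if pselect (exists mu, is_charge_of g mu) is left ex then sval (cid ex)
  else czero.

End NBV.

(* The integral with respect to a signed measure is the difference of the
   integrals with respect to its Jordan components. *)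
Definition charge_integral {d : measure_display} {T : measurableType d}
    {R : realType} (mu : {charge set T -> \bar R}) (D : set T) (f : T -> R) : R :=
  let hP := cid (Hahn_decomposition mu) in
  let hN := cid (svalP hP) in
  let PN := svalP hN in
  \int[jordan_pos PN]_(x in D) f x - \int[jordan_neg PN]_(x in D) f x.

Definition stieltjes_integral {R : realType} (r : R) (g f : R -> R) : R :=
  charge_integral (charge_of r g) `[- r, 0] f.

(* xget selects the element of NBV given by the Riesz representation theorem. *)
Definition riesz1 {R : realType} (r : R) (l : dual (C0 (- r) 0 R)) : R -> R :=
  xget (fun=> 0) [set g | NBV r g /\
    forall phi : C0 (- r) 0 R, l phi = stieltjes_integral r g phi].

Section vector_duals.
Context {R : realType} (n : nat).

Definition basis_vec (k : 'I_n) : 'rV[R]_n := delta_mx 0 k.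

Definition dual_basis_vec (k : 'I_n) : dual 'rV[R]_n :=
  toDual (fun v : 'rV[R]_n => v 0 k).

Definition dual_integral (D : set R) (g : R -> dual 'rV[R]_n) : dual 'rV[R]_n :=
  \sum_(k < n) (\int[lebesgue_measure]_(s in D) g s (basis_vec k))
                 *: dual_basis_vec k.

Definition rieszn (r : R) (L : dual (C0 (- r) 0 'rV[R]_n)) (theta : R) :
    dual 'rV[R]_n :=
  \sum_(k < n)
    riesz1 (toDual (fun phi : C0 (- r) 0 R =>
                      L (toC0 (- r) 0 (fun t => phi t *: basis_vec k)))) theta
    *: dual_basis_vec k.

End vector_duals.

Section variational_problem.
Context {R : realType} (n : nat) (r T : R).
Local Notation H := (C0 (- r) 0 'rV[R]_n).
Local Notation Z := (C0 (- r) T 'rV[R]_n).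

Definition history (x : Z) (t : R) : H :=
  toC0 (- r) 0 (fun theta => x (t + theta)).

Definition X_space : set Z := [set x | C1_on 0 T x].

Definition X_norm (x : Z) : R :=
  `|x| + sup [set `|deriv_on 0 T x t| | t in `[0, T]].

Definition admissible (psi : H) (zeta : 'rV[R]_n) : set Z :=
  [set x | [/\ X_space x, history x 0 = psi & x T = zeta]].

(* Only the values of F t for t in [0, T] matter. *)
Implicit Type F : R -> H -> 'rV[R]_n -> R.

Definition J F (x : Z) : R :=
  \int[lebesgue_measure]_(t in `[0, T]) F t (history x t) (deriv_on 0 T x t).

Definition domain : set (R * H * 'rV[R]_n) := [set p | p.1.1 \in `[0, T]].

Definition D2 F (t : R) (phi : H) (v : 'rV[R]_n) : dual H :=
  toDual ('d (fun phi' : H => F t phi' v) phi).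

Definition D3 F (t : R) (phi : H) (v : 'rV[R]_n) : dual 'rV[R]_n :=
  toDual ('d (F t phi) v).

Definition A1 F : Prop :=
  {within domain, continuous (fun p => F p.1.1 p.1.2 p.2)}.

Definition A2 F : Prop :=
  (forall t phi v, t \in `[0, T] ->
     differentiable (fun phi' : H => F t phi' v) phi) /\
  {within domain, continuous (fun p => D2 F p.1.1 p.1.2 p.2)}.

Definition A3 F : Prop :=
  (forall t phi v, t \in `[0, T] -> differentiable (F t phi) v) /\
  {within domain, continuous (fun p => D3 F p.1.1 p.1.2 p.2)}.

Definition local_solution F (psi : H) (zeta : 'rV[R]_n) (x : Z) : Prop :=
  admissible psi zeta x /\
  exists2 eps : R, 0 < eps &
    forall y : Z, admissible psi zeta y -> X_norm (y - x) < eps ->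
      J F x <= J F y.

End variational_problem.

(* Main.v *)
Require Import Defs.
From HB Require Import structures.
From mathcomp Require Import all_boot all_order all_algebra.
From mathcomp Require Import all_classical all_reals all_analysis.
From mathcomp Require Import measurable_realfun ring lra.

Import Order.TTheory GRing.Theory Num.Theory.
Import numFieldNormedType.Exports.
Local Open Scope classical_set_scope.
Local Open Scope ring_scope.

(** The equation comes from the vanishing of the first variation in the directions
    that keep the history on [- r, 0] and the value at T fixed.

    Write L t and p t for the partial differentials of F along the solution. If h
    is such a direction, the integral over [0, T] of L t (h_t) + p t (h' t) is 0
    (first_variation). Only partial differentials are available, so the increment
    of F is split into an increment in the function variable and one in the vector
    variable, each handled by the mean value theorem; compactness of [0, T] makes
    the difference quotients converge uniformly in t.

    Next take h to be w integrated from 0, times a basis vector, with w continuous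
    and of mean value 0. The history h_t involves w only through its primitive, and
    Fubini's theorem for the charge that represents the coordinate l of L t gives
    (dual_primitive)
      l (h_t) = integral over u in [0, t] of w u * (l 1 - g (u - t)),
    where g = riesz1 l, so that l 1 - g theta is the mass that the charge puts on
    [theta, 0]. A second use of Fubini's theorem collects all that multiplies w u
    (advance_Fubini), and du Bois-Reymond's lemma shows that
      p u + integral over t in [u, T] of (l_t 1 - g_t (u - t))
    is constant. As g_t vanishes to the left of - r, the integral of g_t (u - t)
    over [u, T] is the one in the definition of q; hence q is a constant plus the primitive of
    l_t 1 = g_t 0, which is the claim.

    Du Bois-Reymond's lemma needs the function above to be continuous, although
    each g_t may jump. After the translation t = u + sigma, the variable u only
    enters through the functional l_(u + sigma), which is continuous in norm
    (advance_continuous).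

    All this rests on the Riesz representation theorem, without which riesz1 would
    have no meaning. A functional l is the difference of the positive parts of l and
    of - l (pos_partB). The values of a positive part on ramps, which approximate
    the indicator functions of half-lines, give a left-continuous cumulative
    function (pos_cumul). The difference g of the two cumulative functions is in
    NBV, and every function in NBV has a charge, by its Jordan decomposition
    (charge_of_NBV). As a functional is determined by its values on 1 and, in the
    limit, on ramps (dual_eq0_of_ramps), g represents l. Conversely, by dominated
    convergence, riesz1 l is the limit of the values of l on ramps (riesz1_cvg),
    which makes it measurable and continuous as a function of l. *)

Set Implicit Arguments.
Unset Strict Implicit.
Unset Printing Implicit Defensive.

(** * Charges of functions of bounded variation *)

Section right_regularization.
Context {R : realType} (K : R -> R) (m : R).
Hypothesis ndK : {homo K : x y / x <= y}.
Hypothesis mK : forall x, m <= K x.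

Definition right_reg (t : R) : R := lim (K u @[u --> t^'+]).

Lemma right_reg_cvg t : K u @[u --> t^'+] --> right_reg t.
Proof.
apply: nondecreasing_at_right_is_cvgr.
- by near=> x => a b _ _; exact: ndK.
- by near=> x; exists m => _ [u _ <-].
Unshelve. all: by end_near. Qed.

Lemma right_reg_le t u : t < u -> right_reg t <= K u.
Proof.
move=> tu; apply: limr_le; first exact: right_reg_cvg.
by near=> v; apply: ndK; near: v; exact: nbhs_right_le.
Unshelve. all: by end_near. Qed.

Lemma right_reg_ge t : K t <= right_reg t.
Proof.
apply: limr_ge; first exact: right_reg_cvg.
by near=> v; apply: ndK; near: v; exact: nbhs_right_ge.
Unshelve. all: by end_near. Qed.

Lemma right_reg_nd : {homo right_reg : x y / x <= y}.
Proof.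
move=> x y; rewrite le_eqVlt => /orP[/eqP -> //|xy].
exact: le_trans (right_reg_le xy) (right_reg_ge y).
Qed.

Lemma right_reg_rc t : right_reg s @[s --> t^'+] --> right_reg t.
Proof.
apply/cvgrPdist_le => e e0.
have := @right_reg_cvg t => /cvgrPdist_le/(_ e e0)[d /= d0 H].
have td : t < t + d / 2 by rewrite ltrDl divr_gt0.
near=> s; rewrite distrC ger0_norm; last first.
  by rewrite subr_ge0 right_reg_nd//; near: s; exact: nbhs_right_ge.
have Hd : `|right_reg t - K (t + d / 2)| <= e.
  apply: H => //=; rewrite opprD addNKr normrN gtr0_norm ?divr_gt0//.
  by rewrite ltr_pdivrMr// ltr_pMr// ltr1n.
move: Hd; rewrite ler_distlC => /andP[_ K2]; rewrite lerBlDl.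
apply: le_trans K2; apply: right_reg_le.
by near: s; exact: nbhs_right_lt.
Unshelve. all: by end_near. Qed.

End right_regularization.

(** Functions in NBV are left-continuous, whereas the Lebesgue-Stieltjes measures
    below come from right-continuous functions. The reflection u |-> - u exchanges
    the two: the charge of G is the image, under this reflection, of the measure of
    the right regularization of - G (- u). *)
Section monotone_charge.
Context {R : realType} (r : R) (G Gm : R -> R).
Hypothesis r0 : 0 < r.
Hypothesis ndG : {in `[- r, 0] &, {homo G : x y / x <= y}}.
Hypothesis Gmr : Gm (- r) = G (- r).
Hypothesis GmP : forall t, t \in `]- r, 0[ -> G s @[s --> t^'-] --> Gm t.

Let clamp (v : R) := Num.max (- r) (Num.min v 0).
Let K u := - G (clamp (- u)).

Let clampP v : clamp v \in `[- r, 0].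
Proof.
by rewrite /clamp in_itv/= le_max lexx/= ge_max oppr_le0 ltW//= ge_min lexx orbT.
Qed.

Let clampE v : v \in `[- r, 0] -> clamp v = v.
Proof.
by rewrite in_itv/= => /andP[rv v0]; rewrite /clamp (min_idPl v0); apply/max_idPr.
Qed.

Let clamp_ge v : 0 <= v -> clamp v = 0.
Proof.
move=> v0; rewrite /clamp (min_idPr v0); apply/max_idPr.
by rewrite oppr_le0 ltW.
Qed.

Let clamp_le v : v <= - r -> clamp v = - r.
Proof. by move=> v0; apply/max_idPl; rewrite ge_min v0. Qed.

Let clamp_nd : {homo clamp : x y / x <= y}.
Proof.
move=> x y xy; rewrite /clamp ge_max le_max lexx/= le_max; apply/orP; right.
by rewrite le_min ge_min xy/= ge_min lexx orbT.
Qed.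

Let ndK : {homo K : x y / x <= y}.
Proof. by move=> x y xy; rewrite lerN2 ndG// clamp_nd// lerN2. Qed.

Let mK x : - G 0 <= K x.
Proof.
rewrite lerN2 ndG//; first by rewrite in_itv/= lexx oppr_le0 ltW.
by have := clampP (- x); rewrite in_itv/= => /andP[].
Qed.

Let F := right_reg K.

Let F_lt0 t : t < 0 -> F t = - G 0.
Proof.
move=> t0; apply/eqP; rewrite eq_le; apply/andP; split.
- have t2 : t < t / 2 by lra.
  apply: le_trans (right_reg_le ndK mK t2) _.
  by rewrite /K clamp_ge//; lra.
- by apply: le_trans (right_reg_ge ndK mK t).
Qed.

Let F_ge t : r <= t -> F t = - G (- r).
Proof.
move=> rt; have Kc u : r <= u -> K u = - G (- r).
  by move=> ru; rewrite /K clamp_le// lerN2.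
apply/eqP; rewrite eq_le; apply/andP; split.
- apply: le_trans (right_reg_le ndK mK (_ : t < t + 1)) _; first by rewrite ltrDl.
  by rewrite Kc//; lra.
- by apply: le_trans (right_reg_ge ndK mK t); rewrite Kc.
Qed.

Let F_mid t : t \in `[- r, 0[ -> F (- t) = - Gm t.
Proof.
rewrite in_itv/= => /andP[]; rewrite le_eqVlt => /orP[/eqP <- _|rt t0].
  by rewrite opprK F_ge// Gmr.
have rt0 : t \in `]- r, 0[ by rewrite in_itv/= rt.
have /cvg_at_leftNP GmP' := GmP rt0.
rewrite -[LHS]opprK; congr (- _).
have H : - K u @[u --> (- t)^'+] --> - F (- t).
  by apply: cvgN; exact: (right_reg_cvg ndK mK).
apply: (cvg_unique _ H); first exact: Rhausdorff.
apply: cvg_trans GmP'; apply: near_eq_cvg; near=> u.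
rewrite /K opprK/= clampE// in_itv/=; apply/andP; split.
- by rewrite lerN2; near: u; apply: nbhs_right_le; rewrite ltrNl.
- rewrite oppr_le0 (@le_trans _ _ (- t))//; first by rewrite oppr_ge0 ltW.
Unshelve. all: by end_near. Qed.

HB.instance Definition _ := isCumulative.Build R _ R F
  (right_reg_nd ndK mK) (right_reg_rc ndK mK).

Let lam := lebesgue_stieltjes_measure F.

Let lamE (a b : R) : a <= b -> lam `]a, b]%classic = (F b - F a)%:E.
Proof.
move=> ab; rewrite /lam /lebesgue_stieltjes_measure /measure_extension/=.
rewrite measurable_mu_extE/= ?wlength_itv_bnd ?EFinB//.
exact: is_ocitv.
Qed.

(* Half-open with room on the left of 0, so that the jump of G at 0, reflected,
   has its full mass in D; the rest of the room has mass 0. *)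
Let D : set (measurableTypeR R) := `]- 1, r]%classic.

Let mD : measurable D. Proof. exact: measurable_itv. Qed.

Let Doo : (lam D < +oo)%E.
Proof. by rewrite lamE ?ltry//; move: r0; lra. Qed.

Let opp : measurableTypeR R -> measurableTypeR R := -%R.

Let mopp : measurable_fun setT opp.
Proof. exact: oppr_measurable. Qed.

Let nu := pushforward (charge_of_finite_measure (mfrestr mD Doo)) opp.

HB.instance Definition _ := isMeasurableFun.Build _ _ _ _ opp mopp.

Let nuE A : nu A = lam (opp @^-1` A `&` D).
Proof. by []. Qed.

Let opp_itv a b c d : opp @^-1` [set` Interval (BSide a b) (BSide c d)] =
  [set` Interval (BSide (~~ c) (- d)) (BSide (~~ a) (- b))].
Proof. exact: opp_preimage_itvbndbnd. Qed.

Let lam_neg : lam `]-1, 0[%classic = 0%E.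
Proof.
have mo : measurable (`]-1, 0[%classic : set (measurableTypeR R)).
  exact: measurable_itv.
pose I n : set (measurableTypeR R) := `]-1, (- n.+1%:R^-1)%R]%classic.
apply/(negligibleP _ mo)/(@negligibleS _ _ _ _ (\bigcup_n I n)).
  move=> x/=; rewrite in_itv/= => /andP[x1 x0].
  have [n nx] := ltr_add_invr x0.
  by exists n => //=; rewrite /I/= in_itv/= x1/= lerNr ltW// -subr_lt0 opprK addrC.
apply: negligible_bigcup => n; exists (I n); split => //; first exact: measurable_itv.
apply: etrans (lamE _) _; first by rewrite lerN2 invf_le1 ?ler1n.
by rewrite !F_lt0 ?subrr// oppr_lt0 invr_gt0 ltr0n.
Qed.

Let nu_itv (al : R) : - r <= al -> al < 0 ->
  nu `[al, 0]%classic = (G 0 - Gm al)%:E.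
Proof.
move=> ral al0; rewrite nuE opp_itv/= oppr0 setIidl; last first.
  have H (y : R) : 0 <= y <= - al -> -1 < y <= r.
    by move=> /andP[? ?]; apply/andP; split; lra.
  by move=> x/=; rewrite !in_itv/=; exact: H.
have mo : measurable (`]-1, 0[%classic : set (measurableTypeR R)).
  exact: measurable_itv.
have mc : measurable (`[0, - al]%classic : set (measurableTypeR R)).
  exact: measurable_itv.
rewrite -[LHS]add0e -lam_neg -measureU//; last first.
  apply/seteqP; split => // x [/=]; rewrite !in_itv/= => /andP[_ x0] /andP[x1 _].
  by move: x0; rewrite ltNge x1.
rewrite (_ : _ `|` _ = `]-1, - al]%classic); last first.
  have H (y : R) : -1 < y < 0 \/ 0 <= y <= - al -> -1 < y <= - al.
    by case=> /andP[? ?]; apply/andP; split; lra.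
  apply/seteqP; split => x/=; rewrite !in_itv/=; first exact: H.
  move=> /andP[-> x1]; have [|x0] := ltP x 0; first by left.
  by right; apply/andP; split.
apply: etrans (lamE _) _; first by lra.
rewrite F_mid ?in_itv/= ?ral//= F_lt0 ?opprK 1?addrC//.
Qed.

Lemma monotone_charge : exists mu : {charge set (measurableTypeR R) -> \bar R},
  [/\ (forall A : set (measurableTypeR R), measurable A ->
         A `&` `[- r, 0] = set0 -> mu A = 0%E),
      (forall alpha beta, - r <= alpha -> alpha < beta -> beta < 0 ->
         mu `[alpha, beta[%classic = (Gm beta - Gm alpha)%:E) &
      (forall alpha, - r <= alpha -> alpha < 0 ->
         mu `[alpha, 0]%classic = (G 0 - Gm alpha)%:E)].
Proof.
exists nu; split; last exact: nu_itv.
- move=> A mA A0; rewrite [LHS]nuE.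
  have moA : measurable (opp @^-1` A `&` D).
    by apply: measurableI => //; rewrite -[X in measurable X]setTI; exact: mopp.
  apply/eqP; rewrite eq_le measure_ge0 andbT -lam_neg.
  apply: le_measure; rewrite ?inE//.
  move=> x/= [Ax]; rewrite /D/= !in_itv/= => /andP[-> xr]/=.
  rewrite ltNge; apply/negP => x0.
  have : (A `&` `[- r, 0]) (opp x).
    by split => //=; rewrite in_itv/= lerN2 xr oppr_le0.
  by rewrite A0.
- move=> al be ral albe be0; rewrite [LHS]nuE opp_itv/= setIidl; last first.
    have H (y : R) : - be < y <= - al -> -1 < y <= r.
      by move=> /andP[? ?]; apply/andP; split; lra.
    by move=> x/=; rewrite !in_itv/=; exact: H.
  apply: etrans (lamE _) _; first by rewrite lerN2 ltW.
  have alI : al \in `[- r, 0[ by rewrite in_itv/= ral (lt_trans albe).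
  have beI : be \in `[- r, 0[ by rewrite in_itv/= be0 (le_trans ral) ?ltW.
  by rewrite (F_mid alI) (F_mid beI) opprK addrC.
Unshelve. exact: mopp.
Qed.
End monotone_charge.

(** Jordan's decomposition writes g as a difference of monotone functions, which
    need not inherit the one-sided continuity of g; their one-sided limits still
    have the right difference, because g itself is left-continuous. *)
Lemma charge_of_NBV {R : realType} (r : R) (g : R -> R) :
  0 < r -> NBV r g -> is_charge_of r g (charge_of r g).
Proof.
move=> r0 [bv lc gr g0]; rewrite /charge_of; case: pselect => [ex|]; last first.
  case; suff [mu] : exists mu, is_charge_of r g mu by exists mu.
  have nr0 : - r <= 0 by rewrite oppr_le0 ltW.
  have gE := bounded_variation_pos_neg_tvE bv.
  set p := fine \o pos_tv (- r) g in gE; set n := fine \o neg_tv (- r) g in gE.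
  have ndn : {in `[- r, 0] &, {homo n : x y / x <= y}}.
    exact: fine_neg_tv_nondecreasing.
  have ndp : {in `[- r, 0] &, {homo p : x y / x <= y}}.
    exact/fine_neg_tv_nondecreasing/bounded_variationN.
  have left_lim (G : R -> R) : {in `[- r, 0] &, {homo G : x y / x <= y}} ->
      forall t, t \in `]- r, 0[ -> cvg (G s @[s --> t^'-]).
    move=> ndG t; rewrite in_itv/= => /andP[rt t0].
    apply: nondecreasing_at_left_is_cvgr; near=> u.
    - have ru : - r <= u by near: u; exact: nbhs_left_ge.
      move=> x y; rewrite !in_itv/= => /andP[ux xt] /andP[uy yt].
      by apply: ndG; rewrite in_itv/=; apply/andP; split; lra.
    - have ru : - r <= u by near: u; exact: nbhs_left_ge.
      exists (G 0) => y [s /=]; rewrite in_itv/= => /andP[us st] <-.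
      by apply: ndG; rewrite ?in_itv/=; try (apply/andP; split); lra.
  pose L (G : R -> R) t := if t == - r then G (- r) else lim (G s @[s --> t^'-]).
  have LE G t : t \in `]- r, 0[ -> L G t = lim (G s @[s --> t^'-]).
    by rewrite in_itv/= /L => /andP[/gt_eqF -> _].
  have LP (G : R -> R) : {in `[- r, 0] &, {homo G : x y / x <= y}} ->
      forall t, t \in `]- r, 0[ -> G s @[s --> t^'-] --> L G t.
    by move=> ndG t tI; rewrite LE//; exact: left_lim.
  have Lr G : L G (- r) = G (- r) by rewrite /L eqxx.
  have [mp [mp0 mpI mpJ]] := monotone_charge r0 ndp (Lr p) (LP p ndp).
  have [mn [mn0 mnI mnJ]] := monotone_charge r0 ndn (Lr n) (LP n ndn).
  have gL t : t \in `[- r, 0[ -> g t = L p t - L n t.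
    rewrite in_itv/= => /andP[]; rewrite le_eqVlt => /orP[/eqP <- _|rt t0].
      by rewrite !Lr gE// in_itv/= lexx nr0.
    have tI : t \in `]- r, 0[ by rewrite in_itv/= rt t0.
    apply: (cvg_unique (@Rhausdorff R) (lc _ tI)).
    have : p s - n s @[s --> t^'-] --> L p t - L n t.
      by apply: cvgB; exact: LP.
    apply: cvg_trans; apply: near_eq_cvg; near=> s.
    by rewrite gE// in_itv/= ltW//= (le_trans _ (ltW t0)).
  have E A : cadd mp (cscale (-1) mn) A = (mp A - mn A)%E.
    by rewrite /cadd/= cscaleN1.
  exists (cadd mp (cscale (-1) mn)); split.
  - move=> A mA A0; rewrite [LHS]E mp0// mn0//.
    by rewrite oppe0 adde0.
  - move=> al be ral albe be0; rewrite [LHS]E mpI// mnI//.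
    rewrite !gL ?in_itv/= ?be0 ?ral ?(lt_trans albe)//; last first.
      by rewrite (le_trans ral) ?ltW.
    by rewrite -EFinB; congr EFin; ring.
  - move=> al ral al0; rewrite [LHS]E mpJ// mnJ//.
    rewrite (gL al) ?in_itv/= ?ral// gE ?in_itv/= ?nr0 ?lexx//.
    by rewrite -EFinB; congr EFin; ring.
by case: cid.
Unshelve. all: by end_near. Qed.

(** The conclusion forgets the Hahn decomposition behind the integral. *)
Lemma charge_integralE {R : realType}
    (mu : {charge set (measurableTypeR R) -> \bar R}) :
  exists m1 m2 : {finite_measure set (measurableTypeR R) -> \bar R},
    (forall D f, charge_integral mu D f =
      \int[m1]_(x in D) f x - \int[m2]_(x in D) f x) /\
    (forall A, measurable A -> mu A = (m1 A - m2 A)%E).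
Proof.
rewrite /charge_integral.
set hP := cid _; set hN := cid _.
exists (jordan_pos (svalP hN)), (jordan_neg (svalP hN)); split => // A mA.
by rewrite [LHS](jordan_decomp (svalP hN) mA)/cadd/= cscaleN1.
Qed.

(** * Integrals of bounded functions and continuity on a segment *)

Section bounded_integrals.
Context {d} {X : measurableType d} {R : realType}.
Variables (mu : {measure set X -> \bar R}) (D : set X).
Hypotheses (mD : measurable D) (muD : (mu D < +oo)%E).
Implicit Types (f : X -> R) (M : R).

Lemma bounded_integrable f M : measurable_fun D f ->
  (forall x, D x -> `|f x| <= M) -> mu.-integrable D (EFin \o f).
Proof.
move=> mf fM; apply: measurable_bounded_integrable => //.
exists M; split; first exact: num_real.
by move=> y My x Dx; rewrite /= (le_trans (fM x Dx))// ltW.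
Qed.

Lemma bounded_Rintegral_le f M : measurable_fun D f ->
  (forall x, D x -> `|f x| <= M) ->
  `|\int[mu]_(x in D) f x| <= M * fine (mu D).
Proof.
move=> mf fM; have fi := bounded_integrable mf fM.
apply: le_trans (le_normr_Rintegral mD fi) _.
rewrite -Rintegral_cst//; apply: le_Rintegral => //.
- apply: (@bounded_integrable _ M); first exact: measurableT_comp.
  by move=> x Dx; rewrite normr_id fM.
- apply: (@bounded_integrable _ `|M|); first exact: measurable_cst.
  by move=> x Dx.
Qed.

Lemma bounded_cvg_Rintegral (f_ : nat -> X -> R) f M :
  (forall n, measurable_fun D (f_ n)) ->
  (forall n x, D x -> `|f_ n x| <= M) ->
  (forall x, D x -> f_ n x @[n --> \oo] --> f x) ->
  [/\ measurable_fun D f, (forall x, D x -> `|f x| <= M) &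
      \int[mu]_(x in D) f_ n x @[n --> \oo] --> \int[mu]_(x in D) f x].
Proof.
move=> mf_ fM f_f.
have mf : measurable_fun D f by apply: measurable_fun_cvg f_f.
have fM' x : D x -> `|f x| <= M.
  move=> Dx; apply: (cvgr_to_le (cvg_norm (f_f x Dx))).
  by near=> n; exact: fM.
split => //.
have fi := bounded_integrable mf fM'.
have := @dominated_convergence _ X R mu D mD (fun n => EFin \o f_ n)
  (EFin \o f) (cst M%:E).
case.
- by move=> n; exact/measurable_EFinP.
- exact/measurable_EFinP.
- by apply: aeW => x Dx; apply: cvg_EFin; [exact: nearW|exact: f_f].
- by apply: (@bounded_integrable (cst M) `|M|).
- by apply: aeW => x n Dx; rewrite /= lee_fin fM.
move=> _ _ H.
rewrite /Rintegral; apply: fine_cvg; rewrite fineK//.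
exact: integrable_fin_num.
Unshelve. all: by end_near. Qed.

Lemma Rintegral_bool (P : pred X) : measurable [set x | P x] ->
  \int[mu]_(x in D) ((P x)%:R : R) = fine (mu ([set x | P x] `&` D)).
Proof.
move=> mP; rewrite /Rintegral -integral_indic//; congr fine.
apply: eq_integral => x _; rewrite indicE (_ : (x \in _) = P x)//.
by apply/idP/idP; rewrite inE.
Qed.

End bounded_integrals.

Section within_segment.
Context {R : realType} {V : normedModType R} (a b : R).
Implicit Types f : R -> V.

Lemma within_continuousP f : {within `[a, b], continuous f} <->
  forall x, x \in `[a, b] -> forall e, 0 < e ->
    exists2 d : R, 0 < d &
      forall y, y \in `[a, b] -> `|x - y| < d -> `|f x - f y| < e.
Proof.
split=> [/subspace_continuousP cf x xab e e0|H].
  have /cvgrPdist_lt/(_ e e0) := cf x xab.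
  rewrite near_withinE => /nbhs_ballP[d d0 H]; exists d => // y yab xy.
  exact: H.
apply/subspace_continuousP => x xab; apply/cvgrPdist_lt => e e0.
have [d d0 Hd] := H x xab e e0.
by rewrite near_withinE; apply/nbhs_ballP; exists d => // y xy yab; exact: Hd.
Qed.

(** Heine's theorem: compactness makes the modulus of continuity uniform. *)
Lemma uniformly_continuous_segment f (e : R) :
    {within `[a, b], continuous f} -> 0 < e ->
  exists2 d : R, 0 < d & forall s t, s \in `[a, b] -> t \in `[a, b] ->
    `|s - t| < d -> `|f s - f t| < e.
Proof.
move=> /within_continuousP cf e0.
have e20 : 0 < e / 2 by rewrite divr_gt0.
have /compact_near_coveringP/near_covering_withinP H := @segment_compact R a b.
have {}H : \forall d \near 0^'+, `[a, b]%classic `<=` (fun s => forall t,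
    t \in `[a, b] -> `|s - t| < d -> `|f s - f t| < e).
  apply: H => x xab; have [d d0 Hd] := cf x xab _ e20.
  have d20 : 0 < d / 2 by rewrite divr_gt0.
  near=> s h => /= sab t tab st.
  have hd : h < d / 2 by near: h; exact: nbhs_right_lt.
  have xs : `|x - s| < d / 2.
    by near: s; exact: nbhsx_ballx.
  rewrite (splitr e); apply: le_lt_trans (ler_distD (f x) _ _) _.
  apply: ltrD; first by rewrite distrC; apply: Hd => //; lra.
  apply: Hd => //; apply: le_lt_trans (ler_distD s _ _) _; lra.
near (0 : R)^'+ => d; exists d => //.
by move=> s t sab; apply: (near H d).
Unshelve. all: by end_near. Qed.

End within_segment.

Lemma within_continuous_le {R : realType} {V W : normedModType R} (a b C : R)
    (f : R -> V) (g : R -> W) : {within `[a, b], continuous f} ->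
  (forall s t, s \in `[a, b] -> t \in `[a, b] -> `|g s - g t| <= C * `|f s - f t|) ->
  {within `[a, b], continuous g}.
Proof.
move=> /within_continuousP cf gf; apply/within_continuousP => s sI e e0.
have C0 : 0 < `|C| + 1 by rewrite ltr_wpDl.
have [|d d0 Hd] := cf s sI (e / (`|C| + 1)); first by rewrite divr_gt0.
exists d => // t tI st; apply: le_lt_trans (gf _ _ sI tI) _.
apply: (@le_lt_trans _ _ ((`|C| + 1) * `|f s - f t|)).
  by rewrite ler_wpM2r// (le_trans (ler_norm C))// lerDl.
by rewrite mulrC -ltr_pdivlMr// Hd.
Qed.

Section clamp.
Context {R : realType} (a b : R).

Definition clamp (t : R) := Num.max a (Num.min b t).

Lemma clamp_in t : a <= b -> clamp t \in `[a, b].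
Proof.
by move=> ab; rewrite /clamp in_itv/= le_max lexx/= ge_max ab ge_min lexx.
Qed.

Lemma clamp_id t : t \in `[a, b] -> clamp t = t.
Proof.
rewrite in_itv/= => /andP[at_ tb].
by rewrite /clamp (min_idPr tb) (max_idPr at_).
Qed.

Lemma clamp_continuous : continuous clamp.
Proof.
apply: (@max_fun_continuous _ R R (cst a) (cst b \min id)).
  exact: cst_continuous.
apply: min_fun_continuous; first exact: cst_continuous.
by move=> x; exact: cvg_id.
Qed.

Lemma continuous_clamp {V : topologicalType} (f : R -> V) : a <= b ->
  {within `[a, b], continuous f} -> continuous (f \o clamp).
Proof.
move=> ab /subspace_continuousP cf x.
have cfx := cf (clamp x) (clamp_in x ab).
apply: (@cvg_comp _ _ _ clamp f _ _ _ _ cfx).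
move=> U nU; have H := clamp_continuous nU.
have {}H : nbhs x (fun y => `[a, b]%classic (clamp y) -> U (clamp y)) by [].
change (nbhs x (fun y => U (clamp y))).
by apply: filterS H => y; apply; exact: clamp_in.
Qed.

End clamp.

Section toC0_continuous.
Context {R : realType} (a b : R) {E : normedModType R}.

Lemma toC0_id (f : R -> E) t : continuous f -> t \in `[a, b] -> toC0 a b f t = f t.
Proof. by move=> cf; apply: toC0E; exact: continuous_subspaceT. Qed.

Lemma C0_norm_le_in (f : C0 a b E) M :
  0 <= M -> (forall t, t \in `[a, b] -> `|f t| <= M) -> `|f| <= M.
Proof. exact: C0_norm_le. Qed.

Lemma C0_norm_ub_in (f : C0 a b E) t : t \in `[a, b] -> `|f t| <= `|f|.
Proof. exact: C0_norm_ub. Qed.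

Lemma C0B (f g : C0 a b E) t : (f - g) t = f t - g t.
Proof. by []. Qed.

Lemma C0_sum I (s : seq I) P (f : I -> C0 a b E) t :
  (\sum_(i <- s | P i) f i) t = \sum_(i <- s | P i) f i t.
Proof. by elim/big_ind2 : _ => // u v w z uv wz; rewrite C0D uv wz. Qed.

End toC0_continuous.

Section dual_lemmas.
Context {R : realType} {V : normedModType R}.
Implicit Types (L : dual V) (u v : V).

Lemma dual_argD L u v : L (u + v) = L u + L v.
Proof. by have := dual_linear L 1 u v; rewrite !scale1r. Qed.

Lemma dual_arg0 L : L 0 = 0.
Proof. by rewrite -[X in L X](scale0r (0 : V)) dual_argZ mul0r. Qed.

Lemma dual_argN L u : L (- u) = - L u.
Proof. by rewrite -scaleN1r dual_argZ mulN1r. Qed.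

Lemma dual_argB L u v : L (u - v) = L u - L v.
Proof. by rewrite dual_argD dual_argN. Qed.

Lemma dual_arg_sum L I (s : seq I) P (f : I -> V) :
  L (\sum_(i <- s | P i) f i) = \sum_(i <- s | P i) L (f i).
Proof.
by apply: (big_morph _ (dual_argD L) (dual_arg0 L)).
Qed.

Lemma dual_le L v : `|L v| <= `|L| * `|v|.
Proof. exact: dual_norm_ub. Qed.

(** A bound on f is easier to come by than continuity of f. *)
Lemma toDual_bounded (f : V -> R) M : linear (f : V -> R^o) ->
  (forall v, `|f v| <= M * `|v|) -> toDual f = f :> (V -> R).
Proof.
move=> lf fM; apply: toDualE => //.
have fB u v : f u - f v = f (u - v).
  by have := lf (-1) v u; rewrite !scaleN1r => E; rewrite [LHS]addrC -E addrC.
move=> v; apply/cvgrPdist_lt => e e0.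
have M0 : 0 < `|M| + 1 by rewrite ltr_wpDl.
near=> u; rewrite fB.
apply: (@le_lt_trans _ _ ((`|M| + 1) * `|v - u|)).
  apply: le_trans (fM _) _; rewrite ler_wpM2r//.
  by rewrite (le_trans (ler_norm M))// lerDl.
rewrite mulrC -ltr_pdivlMr//; near: u.
have d0 : 0 < e / (`|M| + 1) by rewrite divr_gt0.
by apply: (@cvgr_dist_lt _ _ _ (nbhs v) _ id v).
Unshelve. all: by end_near. Qed.

End dual_lemmas.

(** * Ramps approximating the indicator functions of half-lines *)

Section ramp.
Context {R : realType}.
Implicit Types (t u : R) (m : nat).

(** As m grows, ramp m t increases to the indicator function of ]-oo, t[: the
    inequality at t is strict, as for the half-open intervals whose charge is an
    increment of a function in NBV. *)
Definition ramp m t u : R := Num.max 0 (Num.min 1 (m%:R * (t - u))).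

Lemma ramp_ge0 m t u : 0 <= ramp m t u.
Proof. by rewrite /ramp le_max lexx. Qed.

Lemma ramp_le1 m t u : ramp m t u <= 1.
Proof. by rewrite /ramp ge_max ler01 ge_min lexx. Qed.

Lemma ramp_norm_le1 m t u : `|ramp m t u| <= 1.
Proof. by rewrite ger0_norm ?ramp_ge0// ramp_le1. Qed.

Lemma ramp_eq0 m t u : t <= u -> ramp m t u = 0.
Proof.
move=> tu; apply/max_idPl; rewrite ge_min; apply/orP; right.
by rewrite mulr_ge0_le0// subr_le0.
Qed.

Lemma ramp_eq1 m t u : 1 <= m%:R * (t - u) -> ramp m t u = 1.
Proof. by move=> h; rewrite /ramp (min_idPl h); apply/max_idPr. Qed.

Lemma ramp_le m m' t t' u :
  m%:R * (t - u) <= m'%:R * (t' - u) -> ramp m t u <= ramp m' t' u.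
Proof.
move=> h; rewrite /ramp ge_max !le_max lexx/=; apply/orP; right.
by rewrite le_min !ge_min lexx/= h orbT.
Qed.

Lemma ramp_nd m t t' u : t <= t' -> ramp m t u <= ramp m t' u.
Proof. by move=> tt'; apply: ramp_le; rewrite ler_wpM2l// lerB. Qed.

Lemma ramp_ndm m m' t u : (m <= m')%N -> ramp m t u <= ramp m' t u.
Proof.
move=> mm'; have [tu|ut] := leP t u; first by rewrite !ramp_eq0.
by apply: ramp_le; rewrite ler_wpM2r ?ler_nat// subr_ge0 ltW.
Qed.

Lemma ramp_lip m t t' u : t' <= t -> ramp m t u <= ramp m t' u + m%:R * (t - t').
Proof.
move=> tt'; have d0 : 0 <= m%:R * (t - t') by rewrite mulr_ge0// subr_ge0.
rewrite [leLHS]/ramp ge_max addr_ge0 ?ramp_ge0//=.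
have [h|h] := leP 1 (m%:R * (t' - u)).
  by rewrite (ramp_eq1 h) ge_min lerDl d0.
rewrite /ramp (min_idPr (ltW h)) ge_min; apply/orP; right.
rewrite -lerBlDr le_max; apply/orP; right.
by rewrite -mulrBr ler_wpM2l//; lra.
Qed.

Lemma ramp_cvg t u : ramp m t u @[m --> \oo] --> ((u < t)%R%:R : R).
Proof.
have [ut|tu] := ltP u t; last first.
  apply: (@cvg_trans _ (cst 0 @ \oo)); last exact: cvg_cst.
  by apply: near_eq_cvg; near=> m; rewrite ramp_eq0.
apply: (@cvg_trans _ (cst 1 @ \oo)); last exact: cvg_cst.
apply: near_eq_cvg; near=> m; rewrite ramp_eq1//.
rewrite -ler_pdivrMr ?subr_gt0// mul1r.
by near: m; exact: nbhs_infty_ger.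
Unshelve. all: by end_near. Qed.

Lemma ramp_continuous m t : continuous (ramp m t).
Proof.
apply: (@max_fun_continuous _ R R (cst 0)
  (cst 1 \min (fun u => m%:R * (t - u)))); first exact: cst_continuous.
apply: min_fun_continuous; first exact: cst_continuous.
move=> u; apply: cvgM; first exact: cvg_cst.
by apply: cvgB; [exact: cvg_cst|exact: cvg_id].
Qed.

End ramp.

Section ramp_C0.
Context {R : realType} (r : R).
Hypothesis r0 : 0 < r.
Local Notation H := (C0 (- r) 0 R).

Definition C0ramp m t : H := toC0 (- r) 0 (ramp m t).

Definition C0one : H := toC0 (- r) 0 (cst (1 : R)).

Lemma C0rampE m t u : u \in `[- r, 0] -> C0ramp m t u = ramp m t u.
Proof. by move=> uI; rewrite toC0_id//; exact: ramp_continuous. Qed.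

Lemma C0oneE u : u \in `[- r, 0] -> C0one u = 1.
Proof. by move=> uI; rewrite toC0_id//; exact: cst_continuous. Qed.

Lemma C0ramp_norm m t : `|C0ramp m t| <= 1.
Proof.
by apply: C0_norm_le_in => // u uI; rewrite C0rampE// ramp_norm_le1.
Qed.

Lemma C0ramp_continuous m : continuous (C0ramp m).
Proof.
move=> t; apply/cvgrPdist_le => e e0; near=> s.
have ts : m%:R * `|t - s| <= e.
  apply: (@le_trans _ _ ((m%:R + 1) * `|t - s|)); first by rewrite ler_wpM2r// lerDl.
  have m1 : 0 < m%:R + 1 :> R by rewrite ltr_wpDl.
  rewrite mulrC -ler_pdivlMr// ltW//; near: s.
  by apply: (@cvgr_dist_lt _ _ _ (nbhs t) _ id t) => //; rewrite divr_gt0// ltr_wpDl.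
apply: C0_norm_le_in => [|u uI]; first exact: ltW.
rewrite [X in `|X|](_ : _ = C0ramp m t u - C0ramp m s u)// !C0rampE//.
apply: le_trans ts; have [st|ts] := leP s t.
  rewrite ger0_norm ?subr_ge0 ?ramp_nd// lerBlDl ger0_norm ?subr_ge0//.
  exact: ramp_lip.
rewrite distrC ger0_norm ?subr_ge0 ?ramp_nd ?(ltW ts)// lerBlDl distrC.
rewrite ger0_norm ?subr_ge0 ?(ltW ts)//; exact: ramp_lip (ltW ts).
Unshelve. all: by end_near. Qed.

Lemma C0one_norm : `|C0one| <= 1.
Proof. by apply: C0_norm_le_in => // u uI; rewrite C0oneE// normr1. Qed.

(** Differences of ramps based at the nodes of a subdivision form a partition of
    unity, so that ramps and the constant 1 span a dense subspace. *)
Lemma dual_eq0_of_ramps (D : dual H) : D C0one = 0 ->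
  (forall t, t \in `]- r, 0[ -> D (C0ramp m t) @[m --> \oo] --> 0) -> D = 0.
Proof.
move=> D1 Dr; apply: dualP => phi; rewrite dual0; apply/eqP; rewrite -normr_le0.
apply/ler_addgt0Pr => e e0; rewrite add0r.
pose e' := e / (`|D| + 1).
have D10 : 0 < `|D| + 1 by rewrite ltr_wpDl.
have e'0 : 0 < e' by rewrite divr_gt0.
have [d d0 Hd] := uniformly_continuous_segment (@C0_within_continuous _ _ _ _ phi) e'0.
(* N steps of length h = r / N, with h below the modulus of continuity d of phi. *)
pose N := (Num.bound (r / d)).+1.
pose h := r / N%:R.
have N0 : 0 < N%:R :> R by rewrite ltr0n.
have h0 : 0 < h by rewrite divr_gt0.
have hd : h < d.
  rewrite /h ltr_pdivrMr// mulrC -ltr_pdivrMr//.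
  apply: lt_le_trans (_ : (Num.bound (r / d))%:R <= _); last by rewrite ler_nat.
  by apply: archi_boundP; rewrite divr_ge0 ?ltW.
pose x i := - r + i%:R * h.
have xN : x N = 0 by rewrite /x /h mulrC divfK ?gt_eqF// addNr.
have xS i : x i.+1 = x i + h by rewrite /x -natr1; ring.
have x_nd i j : (i <= j)%N -> x i <= x j.
  by move=> ij; rewrite lerD2l ler_wpM2r ?ler_nat// ltW.
have x0 : x 0%N = - r by rewrite /x mul0r addr0.
have xI i : (i <= N)%N -> x i \in `[- r, 0].
  by move=> iN; rewrite in_itv/= -x0 -xN !x_nd.
(* The ramp based at - r vanishes on [- r, 0]; at the other end the constant 1
   takes the place of the ramp, so that the bumps add up to 1. *)
pose c m i : H := if i == 0%N then 0 else if i == N then C0one else C0ramp m (x i).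
pose b m i := c m i.+1 - c m i.
pose phi_ m : H := \sum_(0 <= i < N) phi (x i) *: b m i.
have Dc i : (i <= N)%N -> D (c m i) @[m --> \oo] --> 0.
  move=> iN; rewrite /c; have [i0|i0] := eqVneq i 0%N.
    by rewrite dual_arg0; exact: cvg_cst.
  have [iN'|iN'] := eqVneq i N; first by rewrite D1; exact: cvg_cst.
  apply: Dr; rewrite in_itv/= -x0 -xN /x !ltrD2l !ltr_pM2r// !ltr_nat lt0n i0/=.
  by rewrite ltn_neqAle iN' iN.
have Dphi_ : D (phi_ m) @[m --> \oo] --> 0.
  have E : (fun m => D (phi_ m)) =
      fun m => \sum_(i < N) phi (x i) * (D (c m i.+1) - D (c m i)).
    apply/funext => m; rewrite dual_arg_sum big_mkord.
    by apply: eq_bigr => i _; rewrite dual_argZ dual_argB.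
  rewrite E [X in _ --> X](_ : 0 = \sum_(i < N) phi (x i) * (0 - 0)); last first.
    by rewrite big1// => i _; rewrite subrr mulr0.
  apply: cvg_big => [|i _]; first exact: add_continuous.
  by apply: cvgMr; apply: cvgB; apply: Dc => //; exact: ltnW.
have phiE m : 1 <= m%:R * h -> `|phi - phi_ m| <= e'.
  move=> mh; apply: C0_norm_le_in; first exact: ltW.
  move=> u uI; have := uI; rewrite in_itv/= => /andP[ru u0].
  have cE i : (i <= N)%N -> c m i u =
      if i == 0%N then 0 else if i == N then 1 else ramp m (x i) u.
    move=> iN; rewrite /c; case: ifP => // _; case: ifP => _; first exact: C0oneE.
    exact: C0rampE.
  have b_ge0 i : (i < N)%N -> 0 <= b m i u.
    move=> iN; rewrite /b C0B subr_ge0 !cE ?(ltnW iN)//=.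
    have [i0|i0] := eqVneq i 0%N; first by case: ifP => _; rewrite ?ler01 ?ramp_ge0.
    rewrite (ltn_eqF iN); case: ifP => _; first exact: ramp_le1.
    by apply: ramp_nd; rewrite x_nd.
  (* A ramp goes from 1 to 0 within 1 / m <= h, so that the i-th bump lives on the
     two steps around x i. *)
  have b_supp i : (i < N)%N -> b m i u != 0 -> `|u - x i| <= h.
    move=> iN; apply: contraNT; rewrite -ltNge => hu.
    rewrite /b C0B !cE ?(ltnW iN)//=.
    have [ux|xu] := leP u (x i).
      have : h < x i - u by move: hu; rewrite distrC ger0_norm ?subr_ge0.
      move=> {}hu.
      have i0 : i != 0%N.
        by apply/negP => /eqP i0; move: hu; rewrite i0 x0; lra.
      have R1 : ramp m (x i) u = 1.
        by apply: ramp_eq1; apply: le_trans mh _; rewrite ler_wpM2l// ltW.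
      have R2 : ramp m (x i.+1) u = 1.
        apply: ramp_eq1; apply: le_trans mh _; rewrite ler_wpM2l// xS; lra.
      by rewrite (negbTE i0) (ltn_eqF iN) R1 R2; case: ifP => _; rewrite subrr.
    have {}hu : x i.+1 < u.
      by move: hu; rewrite ger0_norm ?subr_ge0 ?ltW// xS; lra.
    case: ifP => [/eqP iN'|_]; first by move: hu; rewrite iN' xN; lra.
    rewrite (ramp_eq0 m (ltW hu)) (ltn_eqF iN) (ramp_eq0 m (ltW xu)).
    by case: ifP => _; rewrite subrr.
  have sum_b : \sum_(0 <= i < N) b m i u = 1.
    transitivity (\sum_(0 <= i < N) (c m i.+1 u - c m i u)); first exact: eq_bigr.
    by rewrite telescope_sumr// !cE//= eqxx subr0.
  rewrite [X in `|X|](_ : _ = phi u - phi_ m u)// /phi_ C0_sum.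
  rewrite -[phi u]mulr1 -sum_b mulr_sumr -sumrB.
  apply: le_trans (ler_norm_sum _ _ _) _.
  rewrite -[e']mulr1 -sum_b mulr_sumr big_nat [leRHS]big_nat.
  apply: ler_sum => i /= iN.
  rewrite [X in _ - X](_ : _ = phi (x i) * b m i u)// -mulrBl normrM.
  rewrite (ger0_norm (b_ge0 _ iN)).
  change (`|phi u - phi (x i)| * b m i u <= e' * b m i u).
  have [->|bi] := eqVneq (b m i u) 0; first by rewrite !mulr0.
  rewrite ler_wpM2r ?b_ge0// ltW// Hd ?xI ?(ltnW iN)//.
  exact: le_lt_trans (b_supp _ iN bi) hd.
apply: (@le_trans _ _ (`|D| * e')); last first.
  by rewrite /e' mulrCA ler_piMr ?(ltW e0)// ler_pdivrMr// mul1r lerDl.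
have : `|D phi - D (phi_ m)| @[m --> \oo] --> `|D phi - 0|.
  by apply: cvg_norm; apply: cvgB => //; exact: cvg_cst.
rewrite subr0 => H; apply: (cvgr_to_le H); near=> m.
rewrite -dual_argB (le_trans (dual_le _ _))// ler_wpM2l// phiE//.
rewrite -ler_pdivrMr//; near: m; exact: nbhs_infty_ger.
Unshelve. all: by end_near. Qed.

End ramp_C0.

(** * The positive part of a continuous linear functional *)

Section positive_part.
Context {R : realType} (r : R).
Hypothesis r0 : 0 < r.
Local Notation H := (C0 (- r) 0 R).
Implicit Types (l : dual H) (phi psi : H).

Let I0 : (0 : R) \in `[- r, 0].
Proof. by rewrite in_itv/= lexx oppr_le0 ltW. Qed.

Definition between0 phi : set H :=
  [set psi | forall u, u \in `[- r, 0] -> 0 <= psi u <= phi u].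

(** The value at phi >= 0 of the positive part of l in the Riesz space of
    functionals. *)
Definition pos_part l phi : R := sup [set l psi | psi in between0 phi].

Definition C0_ge0 phi := forall u, u \in `[- r, 0] -> 0 <= phi u.

Lemma between0_norm phi psi : between0 phi psi -> `|psi| <= `|phi|.
Proof.
move=> h; apply: C0_norm_le_in => [|u uI]; first exact: normr_ge0.
have /andP[p0 pp] := h u uI; rewrite ger0_norm//.
by apply: le_trans pp _; apply: le_trans (ler_norm _) _; exact: C0_norm_ub_in.
Qed.

Lemma pos_part_has_sup l phi : C0_ge0 phi ->
  has_sup [set l psi | psi in between0 phi].
Proof.
move=> phi0; split.
  by exists (l 0), 0 => // u uI; rewrite C00 lexx phi0.
exists (`|l| * `|phi|) => _ [psi h <-].
apply: le_trans (ler_norm _) _; apply: le_trans (dual_le _ _) _.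
by rewrite ler_wpM2l// between0_norm.
Qed.

Lemma pos_part_ub l phi psi : C0_ge0 phi -> between0 phi psi ->
  l psi <= pos_part l phi.
Proof.
move=> phi0 h; apply: ub_le_sup; first exact: (pos_part_has_sup l phi0).2.
by exists psi.
Qed.

Lemma pos_part_le l phi M : C0_ge0 phi ->
  (forall psi, between0 phi psi -> l psi <= M) -> pos_part l phi <= M.
Proof.
move=> phi0 h; apply: ge_sup; first exact: (pos_part_has_sup l phi0).1.
by move=> _ [psi hp <-]; exact: h.
Qed.

(** A competitor for phi becomes one for phi' when cut off at phi', and this costs
    at most c in norm. *)
Lemma pos_part_lip l phi phi' c : C0_ge0 phi -> C0_ge0 phi' -> 0 <= c ->
  (forall u, u \in `[- r, 0] -> phi u <= phi' u + c) ->
  pos_part l phi <= pos_part l phi' + `|l| * c.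
Proof.
move=> phi0 phi'0 c0 h; apply: pos_part_le => // psi hpsi.
pose psi' : H := toC0 (- r) 0 (fun u => Num.min (psi u) (phi' u)).
have psi'E u : u \in `[- r, 0] -> psi' u = Num.min (psi u) (phi' u).
  move=> uI; rewrite toC0E//.
  apply: (@min_fun_continuous _ (subspace `[- r, 0]) R psi phi');
    exact: C0_within_continuous.
have b' : between0 phi' psi'.
  move=> u uI; rewrite psi'E// ge_min lexx orbT andbT le_min phi'0// andbT.
  by have /andP[] := hpsi u uI.
have d' : `|psi - psi'| <= c.
  apply: C0_norm_le_in => // u uI.
  rewrite [X in `|X|](_ : _ = psi u - psi' u)// psi'E//.
  have /andP[p0 pp] := hpsi u uI; have hu := h u uI.
  by have [pq|qp] := leP (psi u) (phi' u);
    rewrite ?subrr ?normr0// ger0_norm; lra.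
have -> : psi = psi' + (psi - psi') by rewrite addrC subrK.
rewrite dual_argD lerD ?pos_part_ub//.
apply: le_trans (ler_norm _) _; apply: le_trans (dual_le _ _) _.
by rewrite ler_wpM2l.
Qed.

Lemma pos_part_mono l phi phi' : C0_ge0 phi -> C0_ge0 phi' ->
  (forall u, u \in `[- r, 0] -> phi u <= phi' u) ->
  pos_part l phi <= pos_part l phi'.
Proof.
move=> phi0 phi'0 h; have := @pos_part_lip l phi phi' 0 phi0 phi'0 (lexx _).
by rewrite mulr0 addr0; apply => u uI; rewrite addr0 h.
Qed.

Lemma pos_part_norm l phi : C0_ge0 phi -> `|phi| <= 1 -> pos_part l phi <= `|l|.
Proof.
move=> phi0 phi1; apply: pos_part_le => // psi h.
apply: le_trans (ler_norm _) _; apply: le_trans (dual_le _ _) _.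
by rewrite ler_piMr// (le_trans (between0_norm h)).
Qed.

(** The substitution psi -> phi - psi exchanges the suprema of l and of - l. *)
Lemma pos_partB l phi : C0_ge0 phi ->
  pos_part l phi - pos_part (- l) phi = l phi.
Proof.
move=> phi0.
have refl psi : between0 phi psi -> between0 phi (phi - psi).
  move=> h u uI; have /andP[p0 pp] := h u uI.
  by rewrite [X in 0 <= X <= _](_ : _ = phi u - psi u)// subr_ge0 pp/= gerBl.
apply/eqP; rewrite subr_eq eq_le; apply/andP; split.
- apply: pos_part_le => // psi h; rewrite -lerBlDl.
  have := pos_part_ub (- l) phi0 (refl _ h).
  by rewrite [X in X <= _](_ : _ = - l (phi - psi))// dual_argB opprB.
- rewrite -lerBrDl; apply: pos_part_le => // psi h.
  have := pos_part_ub l phi0 (refl _ h).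
  rewrite dual_argB => hl.
  by rewrite [X in X <= _](_ : _ = - l psi)// lerBrDl.
Qed.

Lemma C0ramp_ge0 m t : C0_ge0 (C0ramp r m t).
Proof. by move=> u uI; rewrite C0rampE// ramp_ge0. Qed.

Lemma C0one_ge0 : C0_ge0 (C0one r).
Proof. by move=> u uI; rewrite C0oneE// ler01. Qed.

(** The left-continuous cumulative function of the positive part of l, with the
    conventions of NBV: the value at 0 takes in the mass of the point 0. *)
Definition pos_cumul l t : R :=
  if t \in `[- r, 0] then
    if t == 0 then pos_part l (C0one r)
    else sup (range (fun m => pos_part l (C0ramp r m t)))
  else 0.

Let ramp_le' l m m' t t' : (m <= m')%N -> t <= t' ->
  pos_part l (C0ramp r m t) <= pos_part l (C0ramp r m' t').
Proof.
move=> mm' tt'; apply: pos_part_mono; [exact: C0ramp_ge0|exact: C0ramp_ge0|].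
move=> u uI; rewrite !C0rampE//.
by apply: le_trans (ramp_ndm _ _ mm') (ramp_nd _ _ tt').
Qed.

Let ramp_ub l t : has_ubound (range (fun m => pos_part l (C0ramp r m t))).
Proof.
exists `|l| => _ [m _ <-].
by apply: pos_part_norm; [exact: C0ramp_ge0|exact: C0ramp_norm].
Qed.

Lemma pos_cumul_cvg l t : t \in `[- r, 0[ ->
  pos_part l (C0ramp r m t) @[m --> \oo] --> pos_cumul l t.
Proof.
rewrite in_itv/= => /andP[rt t0].
rewrite /pos_cumul in_itv/= rt (ltW t0)/= lt_eqF//.
apply: nondecreasing_cvgn; last exact: ramp_ub.
by move=> m m' mm'; exact: ramp_le'.
Qed.

Lemma pos_cumul_ge l m t : t \in `[- r, 0[ ->
  pos_part l (C0ramp r m t) <= pos_cumul l t.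
Proof.
rewrite in_itv/= => /andP[rt t0].
rewrite /pos_cumul in_itv/= rt (ltW t0)/= lt_eqF//.
by apply: ub_le_sup; [exact: ramp_ub|exists m].
Qed.

Lemma pos_cumul_nd l : {in `[- r, 0] &, {homo pos_cumul l : x y / x <= y}}.
Proof.
move=> x y; rewrite !in_itv/= => /andP[rx x0] /andP[ry y0] xy.
move: x0; rewrite le_eqVlt => /orP[/eqP x0|x0].
  by have -> : y = x by apply/eqP; rewrite eq_le xy x0 y0.
have xI : x \in `[- r, 0[ by rewrite in_itv/= rx.
move: y0; rewrite le_eqVlt => /orP[/eqP y0|y0].
  rewrite [leRHS]/pos_cumul y0 eqxx I0.
  apply: (cvgr_to_le (@pos_cumul_cvg l _ xI)); near=> m.
  apply: pos_part_mono; [exact: C0ramp_ge0|exact: C0one_ge0|].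
  by move=> u uI; rewrite C0rampE// C0oneE// ramp_le1.
have yI : y \in `[- r, 0[ by rewrite in_itv/= ry.
apply: (cvgr_to_le (@pos_cumul_cvg l _ xI)); near=> m.
by apply: le_trans (pos_cumul_ge l m yI); exact: ramp_le'.
Unshelve. all: by end_near. Qed.

(** At a fixed steepness m the ramp is m-Lipschitz in its base point, so a ramp
    that nearly reaches the supremum at t still nearly does so from s < t. *)
Lemma pos_cumul_left_continuous l t : t \in `]- r, 0[ ->
  pos_cumul l s @[s --> t^'-] --> pos_cumul l t.
Proof.
move=> tI; have := tI; rewrite in_itv/= => /andP[rt t0].
have tI' : t \in `[- r, 0[ by rewrite in_itv/= (ltW rt).
apply/cvgrPdist_lt => e e0.
have e20 : 0 < e / 2 by rewrite divr_gt0.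
have /cvgrPdist_lt/(_ _ e20)[m _ /(_ m (leqnn m))/= Hm] := @pos_cumul_cvg l _ tI'.
have D0 : 0 < `|l| * m%:R + 1 by rewrite ltr_wpDl// mulr_ge0.
have d0 : 0 < e / 2 / (`|l| * m%:R + 1) by rewrite divr_gt0.
near=> s.
have st : s <= t by near: s; exact: nbhs_left_le.
have rs : - r <= s by near: s; exact: nbhs_left_ge.
have sI : s \in `[- r, 0[ by rewrite in_itv/= rs (le_lt_trans st).
rewrite ger0_norm; last first.
  by rewrite subr_ge0 pos_cumul_nd// in_itv/= ?rs ?(ltW rt) ltW// (le_lt_trans st).
have h1 : pos_part l (C0ramp r m t) <=
    pos_cumul l s + `|l| * (m%:R * (t - s)).
  apply: le_trans (lerD (pos_cumul_ge l m sI) (lexx _)).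
  apply: pos_part_lip; [exact: C0ramp_ge0|exact: C0ramp_ge0| |].
    by rewrite mulr_ge0// subr_ge0.
  by move=> u uI; rewrite !C0rampE// ramp_lip.
have h2 : `|l| * (m%:R * (t - s)) < e / 2.
  apply: (@le_lt_trans _ _ ((`|l| * m%:R + 1) * (t - s))).
    by rewrite mulrA ler_wpM2r ?subr_ge0// lerDl.
  rewrite mulrC -ltr_pdivlMr// ltrBlDl -ltrBlDr.
  by near: s; apply: nbhs_left_gt; rewrite ltrBlDr ltrDl.
have := ltr_normlW Hm; lra.
Unshelve. all: by end_near. Qed.

End positive_part.

(** * The Riesz representation theorem *)

Section stieltjes_of_NBV.
Context {R : realType} (r : R).
Hypothesis r0 : 0 < r.
Local Notation H := (C0 (- r) 0 R).
Local Notation D := (`[- r, 0]%classic : set (measurableTypeR R)).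

(** The integral against g becomes a difference of integrals against two finite
    measures, of which only the difference on intervals is known. *)
Lemma stieltjes_decomposition (g : R -> R) : NBV r g ->
  exists m1 m2 : {finite_measure set (measurableTypeR R) -> \bar R},
  [/\ (forall f, stieltjes_integral r g f =
         \int[m1]_(u in D) f u - \int[m2]_(u in D) f u),
      (forall t, t \in `]- r, 0[ ->
         fine (m1 `[- r, t[%classic) - fine (m2 `[- r, t[%classic) = g t) &
      (forall t, t \in `[- r, 0[ ->
         fine (m1 `[t, 0]%classic) - fine (m2 `[t, 0]%classic) = g 0 - g t)].
Proof.
move=> gN; have [_ gI gJ] := charge_of_NBV r0 gN.
have [m1 [m2 [mE mA]]] := charge_integralE (charge_of r g).
have gr : g (- r) = 0 by case: gN.
have mF (m : {finite_measure set (measurableTypeR R) -> \bar R}) A :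
    measurable A -> m A \is a fin_num.
  by move=> mA'; exact: fin_num_measure.
exists m1, m2; split; [exact: mE|move=> t|move=> t]; rewrite in_itv/= => /andP[rt t0].
- have mt : measurable (`[- r, t[%classic : set (measurableTypeR R)).
    exact: measurable_itv.
  have := gI (- r) t (lexx _) rt t0; rewrite mA// gr subr0 => /(congr1 fine) /=.
  by rewrite fineB ?mF.
- have mt : measurable (`[t, 0]%classic : set (measurableTypeR R)).
    exact: measurable_itv.
  have := gJ t rt t0; rewrite mA// => /(congr1 fine) /=.
  by rewrite fineB ?mF.
Qed.

Let mD : measurable D. Proof. exact: measurable_itv. Qed.

Let mDoo (m : {finite_measure set (measurableTypeR R) -> \bar R}) :
  (m D < +oo)%E.
Proof. by rewrite ltey_eq fin_num_measure. Qed.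

Lemma C0_measurable (phi : H) : measurable_fun D phi.
Proof.
apply: subspace_continuous_measurable_fun => //; exact: C0_within_continuous.
Qed.

Lemma C0_integrable (m : {finite_measure set (measurableTypeR R) -> \bar R})
  (phi : H) : m.-integrable D (EFin \o phi).
Proof.
apply: (@bounded_integrable _ _ _ m D mD (mDoo m) phi `|phi|).
  exact: C0_measurable.
by move=> u uI; exact: C0_norm_ub_in.
Qed.

Lemma ramp_integral_cvg (m : {finite_measure set (measurableTypeR R) -> \bar R}) t :
  t \in `]- r, 0[ ->
  \int[m]_(u in D) C0ramp r k t u @[k --> \oo] --> fine (m `[- r, t[%classic).
Proof.
rewrite in_itv/= => /andP[rt t0].
have E : fine (m `[- r, t[%classic) = \int[m]_(u in D) ((u < t)%R%:R : R).
  have -> : `[- r, t[%classic =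
      [set u : measurableTypeR R | (u < t)%R] `&` D.
    apply/seteqP; split => u/=; rewrite !in_itv/=.
      by move=> /andP[-> ut]; rewrite ut (ltW (lt_trans ut t0)).
    by case=> -> /andP[-> _].
  rewrite Rintegral_bool// -set_itvNyo; exact: measurable_itv.
rewrite E.
have [] := @bounded_cvg_Rintegral _ _ R m D mD (mDoo m)
  (fun k => C0ramp r k t) (fun u => (u < t)%R%:R) 1 => //.
- by move=> k; exact: C0_measurable.
- by move=> k u uI; rewrite C0rampE// ramp_norm_le1.
- move=> u uI; rewrite (_ : (fun k => _) = (fun k => ramp k t u)).
    exact: ramp_cvg.
  by apply/funext => k; rewrite C0rampE.
Qed.

Variable g : R -> R.
Hypothesis gN : NBV r g.

Lemma stieltjes_ramp_cvg t : t \in `]- r, 0[ ->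
  stieltjes_integral r g (C0ramp r k t) @[k --> \oo] --> g t.
Proof.
move=> tI; have [m1 [m2 [mE mI _]]] := stieltjes_decomposition gN.
rewrite -(mI _ tI); under eq_fun do rewrite mE.
by apply: cvgB; exact: ramp_integral_cvg.
Qed.

Lemma stieltjes_one : stieltjes_integral r g (C0one r) = g 0.
Proof.
have [m1 [m2 [mE _ mJ]]] := stieltjes_decomposition gN.
have gr : g (- r) = 0 by case: gN.
have rI : - r \in `[- r, 0[ by rewrite in_itv/= lexx oppr_lt0.
rewrite mE; have := mJ _ rI; rewrite gr subr0 => <-.
have E (m : {finite_measure set (measurableTypeR R) -> \bar R}) :
    \int[m]_(u in D) C0one r u = fine (m D).
  rewrite -[RHS]mul1r -Rintegral_cst//; apply: eq_Rintegral => u.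
  by rewrite inE => uI; rewrite C0oneE.
by rewrite !E.
Qed.

Lemma stieltjes_linear : linear (fun phi : H => stieltjes_integral r g phi : R^o).
Proof.
have [m1 [m2 [mE _ _]]] := stieltjes_decomposition gN.
move=> k f1 f2; rewrite !mE.
have E (m : {finite_measure set (measurableTypeR R) -> \bar R}) :
    \int[m]_(u in D) (k *: f1 + f2) u =
    k * \int[m]_(u in D) f1 u + \int[m]_(u in D) f2 u.
  rewrite -RintegralZl//; last exact: C0_integrable.
  by rewrite -RintegralD//; [exact: (C0_integrable m (k *: f1))|exact: C0_integrable].
rewrite !E /GRing.scale/=; ring.
Qed.

Lemma stieltjes_bounded : exists M : R,
  forall phi : H, `|stieltjes_integral r g phi| <= M * `|phi|.
Proof.
have [m1 [m2 [mE _ _]]] := stieltjes_decomposition gN.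
exists (fine (m1 D) + fine (m2 D)) => phi; rewrite mE.
apply: le_trans (ler_normB _ _) _; rewrite mulrC mulrDr.
have B (m : {finite_measure set (measurableTypeR R) -> \bar R}) :
    `|\int[m]_(u in D) phi u| <= `|phi| * fine (m D).
  apply: (bounded_Rintegral_le mD (mDoo m)); first exact: C0_measurable.
  by move=> u uI; exact: C0_norm_ub_in.
by rewrite lerD.
Qed.

End stieltjes_of_NBV.

Section riesz.
Context {R : realType} (r : R).
Hypothesis r0 : 0 < r.
Local Notation H := (C0 (- r) 0 R).
Implicit Types l : dual H.

Let g_ l := pos_cumul l \- pos_cumul (- l).

Let g_cvg l t : t \in `[- r, 0[ -> l (C0ramp r m t) @[m --> \oo] --> g_ l t.
Proof.
move=> tI.
have : pos_part l (C0ramp r m t) - pos_part (- l) (C0ramp r m t)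
    @[m --> \oo] --> g_ l t by apply: cvgB; exact: pos_cumul_cvg.
apply: cvg_trans; apply: near_eq_cvg; near=> m.
by rewrite /= pos_partB//; exact: C0ramp_ge0.
Unshelve. all: by end_near. Qed.

Let C0ramp_eq0 m t : t <= - r -> C0ramp r m t = 0.
Proof.
move=> tr; apply: C0P => u uI; rewrite C0rampE// C00 ramp_eq0//.
by apply: le_trans tr _; move: uI; rewrite in_itv/= => /andP[].
Qed.

Let C0ramp_cvg0 l t : t <= - r -> l (C0ramp r m t) @[m --> \oo] --> (0 : R).
Proof.
move=> tr; rewrite (_ : (fun m => _) = cst 0); first exact: cvg_cst.
by apply/funext => m; rewrite C0ramp_eq0// dual_arg0.
Qed.

Let g_0 l : g_ l 0 = l (C0one r).
Proof.
rewrite /g_/= /pos_cumul eqxx in_itv/= lexx oppr_le0 ltW//=.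
by rewrite pos_partB//; exact: C0one_ge0.
Qed.

Let g_NBV l : NBV r (g_ l).
Proof.
split.
- have mrv0 : - r < 0 by rewrite oppr_lt0.
  apply: bounded_variationD => //; last apply: bounded_variationN;
    by apply: nondecreasing_bounded_variation; exact: pos_cumul_nd.
- by move=> t tI; apply: cvgB; exact: pos_cumul_left_continuous.
- have rI : - r \in `[- r, 0[ by rewrite in_itv/= lexx oppr_lt0.
  by apply: (cvg_unique (@Rhausdorff R) (@g_cvg l _ rI)); exact: C0ramp_cvg0.
- by move=> t /negbTE tI; rewrite /g_/= /pos_cumul tI subrr.
Qed.

(** The candidate g and l agree on all ramps in the limit, hence everywhere. *)
Lemma riesz_representation l : exists g, NBV r g /\
  forall phi : H, l phi = stieltjes_integral r g phi.
Proof.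
exists (g_ l); split=> // phi.
have gN := g_NBV l.
have [M HM] := stieltjes_bounded r0 gN.
pose S : dual H := toDual (fun phi : H => stieltjes_integral r (g_ l) phi).
have SE psi : S psi = stieltjes_integral r (g_ l) psi.
  by rewrite /S (toDual_bounded _ HM)//; exact: stieltjes_linear.
suff lS : l - S = 0.
  by rewrite -SE -[l in LHS](subrK S) lS add0r.
apply: dual_eq0_of_ramps => //.
  rewrite [LHS](_ : _ = l (C0one r) - S (C0one r))// SE.
  by rewrite stieltjes_one// g_0 subrr.
move=> t tI.
rewrite [X in X @ _ --> _](_ : _ = fun m => l (C0ramp r m t) -
    stieltjes_integral r (g_ l) (C0ramp r m t)); last first.
  by apply/funext => m; rewrite -SE.
rewrite -[X in _ --> X](subrr (g_ l t)); apply: cvgB.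
  by apply: g_cvg; move: tI; rewrite !in_itv/= => /andP[/ltW -> ->].
exact: stieltjes_ramp_cvg.
Qed.

Lemma riesz1P l : NBV r (riesz1 l) /\
  forall phi : H, l phi = stieltjes_integral r (riesz1 l) phi.
Proof.
rewrite /riesz1; case: xgetP => [g _ //|nex].
by have [g gP] := riesz_representation l; case: (nex g).
Qed.

Lemma riesz1_0 l : riesz1 l 0 = l (C0one r).
Proof. by have [gN ->] := riesz1P l; rewrite stieltjes_one. Qed.

Lemma riesz1_out l t : t \notin `[- r, 0] -> riesz1 l t = 0.
Proof. by have [[_ _ _ g0] _] := riesz1P l; exact: g0. Qed.

(** The values on ramps determine riesz1 l, which is therefore continuous in l, and
    measurable in any parameter on which l depends continuously. *)
Lemma riesz1_cvg l t : t < 0 -> l (C0ramp r m t) @[m --> \oo] --> riesz1 l t.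
Proof.
move=> t0; have [[bv lc gr gout] gl] := riesz1P l.
have [rt|tr] := ltP (- r) t.
  rewrite (_ : (fun m => l _) =
      fun m => stieltjes_integral r (riesz1 l) (C0ramp r m t)).
    by apply: stieltjes_ramp_cvg => //; rewrite in_itv/= rt.
  by apply/funext => m; rewrite gl.
have -> : riesz1 l t = 0.
  move: tr; rewrite le_eqVlt => /orP[/eqP -> //|tr].
  by rewrite gout// in_itv/= leNgt tr.
exact: C0ramp_cvg0.
Qed.

Lemma riesz1_lip l l' t : `|riesz1 l t - riesz1 l' t| <= `|l - l'|.
Proof.
have B (phi : H) : `|phi| <= 1 -> `|l phi - l' phi| <= `|l - l'|.
  move=> phi1; rewrite [X in `|X|](_ : _ = (l - l') phi)//.
  by apply: le_trans (dual_le _ _) _; rewrite ler_piMr.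
have [t0|] := ltP t 0.
  have H : `|l (C0ramp r m t) - l' (C0ramp r m t)| @[m --> \oo] -->
      `|riesz1 l t - riesz1 l' t|.
    by apply: cvg_norm; apply: cvgB; exact: riesz1_cvg.
  apply: (cvgr_to_le H); near=> m.
  by apply: B; exact: C0ramp_norm.
rewrite le_eqVlt => /orP[/eqP <-|t0]; first by rewrite !riesz1_0 B// C0one_norm.
by rewrite !riesz1_out ?subrr ?normr0// in_itv/= andbC leNgt t0.
Unshelve. all: by end_near. Qed.

Lemma riesz1_bound l t : `|riesz1 l t| <= `|l|.
Proof.
have B (phi : H) : `|phi| <= 1 -> `|l phi| <= `|l|.
  by move=> phi1; apply: le_trans (dual_le _ _) _; rewrite ler_piMr.
have [t0|] := ltP t 0.
  have H : `|l (C0ramp r m t)| @[m --> \oo] --> `|riesz1 l t|.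
    by apply: cvg_norm; exact: riesz1_cvg.
  apply: (cvgr_to_le H); near=> m.
  by apply: B; exact: C0ramp_norm.
rewrite le_eqVlt => /orP[/eqP <-|t0]; first by rewrite !riesz1_0 B// C0one_norm.
by rewrite riesz1_out ?normr0// in_itv/= andbC leNgt t0.
Unshelve. all: by end_near. Qed.

End riesz.

(** * Fubini's theorem and integration by parts *)

(** Fubini's theorem for a bounded function on a rectangle of finite measure, where
    integrability is automatic. *)
Section bounded_Fubini.
Context {d1 d2} {X : measurableType d1} {Y : measurableType d2} {R : realType}.
Variables (m1 : {sigma_finite_measure set X -> \bar R}).
Variables (m2 : {sigma_finite_measure set Y -> \bar R}).
Variables (D1 : set X) (D2 : set Y) (f : X -> Y -> R) (M : R).
Hypotheses (mD1 : measurable D1) (mD2 : measurable D2).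
Hypotheses (D1oo : (m1 D1 < +oo)%E) (D2oo : (m2 D2 < +oo)%E).
Hypothesis mf : measurable_fun (D1 `*` D2) (fun p => f p.1 p.2).
Hypothesis fM : forall x y, D1 x -> D2 y -> `|f x y| <= M.

Let F : X * Y -> R := (fun p => f p.1 p.2) \_ (D1 `*` D2).

Let mD : measurable (D1 `*` D2). Proof. exact: measurableX. Qed.

Let mF : measurable_fun setT F.
Proof. by apply/(measurable_restrict _ mD measurableT); rewrite setTI. Qed.

Let FE x y : F (x, y) = if (x \in D1) && (y \in D2) then f x y else 0.
Proof. by rewrite /F patchE in_setX. Qed.

Lemma measurable_slice1 x : D1 x -> measurable_fun D2 (f x).
Proof.
move=> xD; apply: (@eq_measurable_fun _ _ _ _ D2 (fun y => F (x, y))).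
  by move=> y yD; rewrite FE yD mem_set.
by apply: measurable_funTS; apply: measurableT_comp => //; exact: pair1_measurable.
Qed.

Lemma measurable_slice2 y : D2 y -> measurable_fun D1 (f ^~ y).
Proof.
move=> yD; apply: (@eq_measurable_fun _ _ _ _ D1 (fun x => F (x, y))).
  by move=> x xD; rewrite FE xD mem_set.
by apply: measurable_funTS; apply: measurableT_comp => //; exact: pair2_measurable.
Qed.

Let slice1_fin x : D1 x -> (\int[m2]_(y in D2) (f x y)%:E)%E \is a fin_num.
Proof.
move=> xD; apply: integrable_fin_num => //.
apply: (@bounded_integrable _ _ _ m2 D2 mD2 D2oo (f x) M).
  exact: measurable_slice1.
by move=> y yD; exact: fM.
Qed.

Let slice2_fin y : D2 y -> (\int[m1]_(x in D1) (f x y)%:E)%E \is a fin_num.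
Proof.
move=> yD; apply: integrable_fin_num => //.
apply: (@bounded_integrable _ _ _ m1 D1 mD1 D1oo (f ^~ y) M).
  exact: measurable_slice2.
by move=> x xD; exact: fM.
Qed.

Let int1 x : (\int[m2]_y (F (x, y))%:E =
  if x \in D1 then \int[m2]_(y in D2) (f x y)%:E else 0)%E.
Proof.
case: ifPn => xD; last first.
  by rewrite integral0_eq// => y _; rewrite FE (negbTE xD).
rewrite [RHS]integral_mkcond; apply: eq_integral => y _.
by rewrite patchE FE xD/=; case: ifP.
Qed.

Let int2 y : (\int[m1]_x (F (x, y))%:E =
  if y \in D2 then \int[m1]_(x in D1) (f x y)%:E else 0)%E.
Proof.
case: ifPn => yD; last first.
  by rewrite integral0_eq// => x _; rewrite FE (negbTE yD) andbF.
rewrite [RHS]integral_mkcond; apply: eq_integral => x _.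
by rewrite patchE FE yD andbT; case: ifP.
Qed.

Let iF : (m1 \x m2)%E.-integrable setT (EFin \o F).
Proof.
apply/integrable12ltyP; first exact/measurable_EFinP.
apply: (@le_lt_trans _ _ (\int[m1]_(x in D1) (`|M|%:E * m2 D2))%E); last first.
  rewrite integral_cst// lte_mul_pinfty//; first by rewrite mule_ge0.
  by rewrite fin_numM// ge0_fin_numE.
rewrite [leRHS]integral_mkcond; apply: ge0_le_integral => //.
- by move=> x xT; exact: integral_ge0.
- apply: (@measurable_fun_fubini_tonelli_F _ _ _ _ _ _ (fun p => `|(F p)%:E|%E)) => //.
  by apply: measurableT_comp => //; exact/measurable_EFinP.
- by apply/(measurable_restrict _ mD1 measurableT); exact: measurable_cst.
- move=> x _; rewrite patchE; case: ifPn => xD; last first.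
    by rewrite integral0_eq// => y _; rewrite /= FE (negbTE xD)/= normr0.
  rewrite -integral_cst// [leRHS]integral_mkcond; apply: ge0_le_integral => //.
  + apply: measurableT_comp => //; apply/measurable_EFinP.
    by apply: measurableT_comp => //; exact: pair1_measurable.
  + by apply/(measurable_restrict _ mD2 measurableT); exact: measurable_cst.
  + move=> y _; rewrite patchE /= FE xD/=; case: ifPn => yD; last by rewrite normr0.
    by rewrite lee_fin (le_trans (fM (set_mem xD) (set_mem yD)))// ler_norm.
Qed.

Lemma bounded_Fubini :
  \int[m1]_(x in D1) \int[m2]_(y in D2) f x y =
  \int[m2]_(y in D2) \int[m1]_(x in D1) f x y.
Proof.
rewrite /Rintegral.
transitivity (fine (\int[m1]_x \int[m2]_y (F (x, y))%:E)%E).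
  congr fine; rewrite [LHS]integral_mkcond; apply: eq_integral => x _.
  rewrite int1 patchE; case: ifP => // xD; rewrite fineK//.
  by apply: slice1_fin; exact: set_mem.
rewrite (Fubini iF); congr fine; rewrite [RHS]integral_mkcond.
apply: eq_integral => y _; rewrite [LHS]int2 patchE; case: ifP => // yD.
by rewrite fineK//; apply: slice2_fin; exact: set_mem.
Qed.

Lemma measurable_Rintegral :
  measurable_fun D2 (fun y => \int[m1]_(x in D1) f x y).
Proof.
apply: (@eq_measurable_fun _ _ _ _ D2 (fun y => fine (\int[m1]_x (F (x, y))%:E)%E)).
  by move=> y yD; rewrite /= int2 yD.
apply: measurable_funTS; apply: measurableT_comp => //.
exact: (measurable_fubini_G iF).
Qed.

End bounded_Fubini.

(** Freezing the first variable on the steps of a fine grid makes f the limit of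
    functions that are measurable for the product structure. *)
Lemma measurable_caratheodory {R : realType} (f : R -> R -> R) :
  (forall y, continuous (f ^~ y)) -> (forall x, measurable_fun setT (f x)) ->
  measurable_fun setT (fun p : R * R => f p.1 p.2).
Proof.
move=> cf mf.
pose g n (x : R) : R := (Num.floor (n.+1%:R * x))%:~R / n.+1%:R.
apply: (@measurable_fun_cvg _ _ _ setT (fun n p => f (g n p.1) p.2)); last first.
  move=> [x y] _ /=.
  apply: (@cvg_comp _ _ _ (fun n => g n x) (f ^~ y) _ (nbhs x)); last exact: cf.
  apply/cvgrPdist_le => e e0; near=> n.
  have n0 : 0 < n.+1%:R :> R by rewrite ltr0n.
  have /andP[fl fu] := floor_itv (n.+1%:R * x).
  have -> : x - g n x = (n.+1%:R * x - (Num.floor (n.+1%:R * x))%:~R) / n.+1%:R.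
    by rewrite /g mulrBl [n.+1%:R * x]mulrC mulfK ?gt_eqF.
  rewrite ger0_norm ?divr_ge0 ?subr_ge0// ler_pdivrMr//.
  apply: (@le_trans _ _ 1); first by rewrite lerBlDl ltW// -intrD1.
  rewrite -ler_pdivrMl// mulr1; near: n.
  by exists (Num.bound e^-1) => // n /= ne; rewrite (le_trans (ltW (archi_boundP _)))
    ?invr_ge0 ?(ltW e0)// ler_nat (leq_trans ne).
move=> n _ A mA; rewrite setTI.
pose K (k : int) : set R := [set x | Num.floor (n.+1%:R * x) == k].
rewrite (_ : _ @^-1` A = \bigcup_k (K k `*` (f (k%:~R / n.+1%:R) @^-1` A))); last first.
  apply/seteqP; split => [[x y]/= Ax|[x y]/= [k _ [/eqP /= kx]]].
    by exists (Num.floor (n.+1%:R * x)) => //; split => //=; rewrite /K/=.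
  by rewrite /g kx.
apply: countable_bigcupT_measurable => [|k]; first exact: countableP.
apply: measurableX; last first.
  by rewrite -[X in measurable X]setTI; exact: mf.
rewrite (_ : K k = `[k%:~R / n.+1%:R, (k + 1)%:~R / n.+1%:R[%classic).
  exact: measurable_itv.
apply/seteqP; split => x /=; rewrite /K/= floor_eq in_itv/=.
  by rewrite ler_pdivrMr ?ltr0n// ltr_pdivlMr ?ltr0n// mulrC.
by rewrite ler_pdivrMr ?ltr0n// ltr_pdivlMr ?ltr0n// mulrC.
Unshelve. all: by end_near. Qed.

Section integration_by_parts.
Context {R : realType} (r : R).
Hypothesis r0 : 0 < r.
Local Notation H := (C0 (- r) 0 R).
Local Notation lebesgue := (@lebesgue_measure R).
Local Notation D := (`[- r, 0]%classic : set (measurableTypeR R)).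
Variable w : R -> R.
Hypothesis cw : continuous w.

(** The primitive of w on the right of 0, extended by 0 to the left of 0. *)
Definition primitive (t : R) : R := \int[lebesgue]_(u in `[0, t]) w u.

Lemma lebesgue_itvcc_lty (a b : R) : (lebesgue `[a, b]%classic < +oo)%E.
Proof. by rewrite lebesgue_measure_itv/=; case: ifP; rewrite ?ltry// -EFinB ltry. Qed.

Lemma continuous_bounded_itv (f : R -> R) (a b : R) : continuous f ->
  exists M : R, forall u, u \in `[a, b] -> `|f u| <= M.
Proof.
move=> cf; have /continuous_compact/(_ (@segment_compact _ a b)) :
  {within `[a, b], continuous f} by exact: continuous_subspaceT.
move=> /compact_bounded[M [_ Mf]]; exists (M + 1) => u uI.
by apply: (Mf (M + 1)); [rewrite ltrDl|exists u].
Qed.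

Lemma primitive_le0 t : t <= 0 -> primitive t = 0.
Proof.
rewrite le_eqVlt => /orP[/eqP ->|t0]; rewrite /primitive.
  by rewrite set_itv1 Rintegral_set1.
by rewrite set_itv_ge ?Rintegral_set0// bnd_simp -ltNge.
Qed.

(** Integration by parts for the charge of l: both sides are the integral of
    (u <= s + theta) w u over the product of that charge and Lebesgue measure. *)
Lemma dual_primitive (l : dual H) (s : R) (phi : H) : 0 <= s ->
  (forall theta, theta \in `[- r, 0] -> phi theta = primitive (s + theta)) ->
  l phi = \int[lebesgue]_(u in `[0, s]) (w u * (l (C0one r) - riesz1 l (u - s))).
Proof.
move=> s0 phiE; have [gN gl] := riesz1P r0 l.
have [m1 [m2 [mE _ mJ]]] := stieltjes_decomposition r0 gN.
have [M wM] := continuous_bounded_itv 0 s cw.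
pose k (theta u : R) : R := (u <= s + theta)%R%:R * w u.
have mD : measurable D by exact: measurable_itv.
have m0s : measurable (`[0, s]%classic : set R) by exact: measurable_itv.
have mk : measurable_fun (D `*` `[0, s]%classic) (fun p => k p.1 p.2).
  apply: measurable_funTS; apply: measurable_funM; last first.
    by apply: measurableT_comp => //; exact: continuous_measurable_fun.
  pose A : set (measurableTypeR R * R) := [set p | (p.2 <= s + p.1)%R].
  have mA : measurable A.
    have mh : measurable_fun setT (fun p : measurableTypeR R * R => s + p.1 - p.2).
      by apply: measurable_funB => //; apply: measurable_funD.
    have := mh measurableT _ (measurable_itv `[0, +oo[).
    rewrite setTI (_ : _ @^-1` _ = A)//; apply/seteqP; split=> p /=;
      by rewrite in_itv/= andbT subr_ge0.
  rewrite [X in measurable_fun _ X](_ : _ = \1_A); first exact: measurable_indic.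
  apply/funext => p; rewrite indicE (_ : (p \in A) = (p.2 <= s + p.1)%R)//.
  by apply/idP/idP; rewrite inE.
have bool1 (b : bool) : `|b%:R : R| <= 1 by case: b; rewrite ?normr1 ?normr0.
have kM theta u : D theta -> `[0, s]%classic u -> `|k theta u| <= M.
  by move=> _ us; rewrite /k normrM (le_trans _ (wM u us))// ler_piMl.
have mDoo (m : {finite_measure set (measurableTypeR R) -> \bar R}) : (m D < +oo)%E.
  by rewrite ltey_eq fin_num_measure.
have phik theta : theta \in `[- r, 0] ->
    phi theta = \int[lebesgue]_(u in `[0, s]) k theta u.
  rewrite in_itv/= => /andP[rt t0].
  rewrite phiE ?in_itv/= ?rt// /primitive.
  rewrite (_ : `[0, s + theta]%classic = `[0, s]%classic `&` `]-oo, s + theta]%classic).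
    rewrite Rintegral_mkcondr; apply: eq_Rintegral => u _; rewrite patchE /k.
    rewrite mem_setE in_itv/=; case: ifP => _; first by rewrite mul1r.
    by rewrite mul0r.
  apply/seteqP; split => u/=; rewrite !in_itv/=.
    by move=> /andP[-> ut]; rewrite ut (le_trans ut)// gerDl.
  by case=> /andP[-> _].
(* The sections of {u <= s + theta} in theta are the segments [c u, 0]. *)
pose c (u : R) := Num.max (- r) (u - s).
have kc (m : {finite_measure set (measurableTypeR R) -> \bar R}) (u : R) :
    `[0, s]%classic u ->
    \int[m]_(theta in D) k theta u = w u * fine (m `[c u, 0]%classic).
  move=> us.
  have mP : measurable [set x : measurableTypeR R | (u <= s + x)%R].
    rewrite (_ : [set x | _] = `[u - s, +oo[%classic); first exact: measurable_itv.
    by apply/seteqP; split => x/=; rewrite in_itv/= andbT lerBlDl.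
  rewrite RintegralZr//; last first.
    apply: (@bounded_integrable _ _ _ m _ mD (mDoo m) _ 1); last first.
      by move=> x _; exact: bool1.
    rewrite [X in measurable_fun _ X](_ : _ =
        \1_[set x : measurableTypeR R | (u <= s + x)%R]).
      exact: measurable_indic.
    apply/funext => x; rewrite indicE (_ : (x \in _) = (u <= s + x)%R)//.
    by apply/idP/idP; rewrite inE.
  rewrite Rintegral_bool// mulrC; congr (_ * fine (m _)).
  apply/seteqP; split => x/=; rewrite !in_itv/= /c ge_max.
    by case=> h /andP[-> ->]; rewrite lerBlDl h.
  by rewrite lerBlDl => /andP[/andP[-> ->] ->].
have main (m : {finite_measure set (measurableTypeR R) -> \bar R}) :
    \int[m]_(theta in D) phi theta =
    \int[lebesgue]_(u in `[0, s]) (w u * fine (m `[c u, 0]%classic)).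
  transitivity (\int[m]_(theta in D) \int[lebesgue]_(u in `[0, s]) k theta u).
    by apply: eq_Rintegral => theta; rewrite inE => tI; rewrite phik.
  rewrite (@bounded_Fubini _ _ _ _ R m lebesgue _ _ k M mD m0s (mDoo m)
    (lebesgue_itvcc_lty 0 s) mk kM).
  by apply: eq_Rintegral => u; rewrite inE => us; rewrite kc.
have int (m : {finite_measure set (measurableTypeR R) -> \bar R}) :
    lebesgue.-integrable `[0, s] (EFin \o (fun u => w u * fine (m `[c u, 0]%classic))).
  apply: (@bounded_integrable _ _ _ lebesgue _ m0s (lebesgue_itvcc_lty 0 s) _
    (M * fine (m D))).
    apply: (@eq_measurable_fun _ _ _ _ _ (fun u => \int[m]_(theta in D) k theta u)).
      by move=> u; rewrite inE => us; rewrite kc.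
    exact: (@measurable_Rintegral _ _ _ _ R m lebesgue _ _ k M mD m0s (mDoo m)
      (lebesgue_itvcc_lty 0 s) mk kM).
  move=> u us; rewrite -kc//.
  apply: (bounded_Rintegral_le mD (mDoo m)); last by move=> t tI; exact: kM.
  exact: (measurable_slice2 mD m0s mk).
rewrite gl mE !main -RintegralB//.
have dE u : u \in `[0, s[ ->
    w u * fine (m1 `[c u, 0]%classic) - w u * fine (m2 `[c u, 0]%classic) =
    w u * (l (C0one r) - riesz1 l (u - s)).
  rewrite in_itv/= => /andP[u0 us].
  have cI : c u \in `[- r, 0[.
    by rewrite in_itv/= /c le_max lexx/= gt_max oppr_lt0 r0/= subr_lt0.
  rewrite -mulrBr mJ// riesz1_0//; congr (_ * (_ - _)); rewrite /c.
  have [usr|//] := leP (u - s) (- r).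
  move: usr; rewrite le_eqVlt => /orP[/eqP -> //|usr].
  have [_ _ -> _] := gN.
  by rewrite riesz1_out// in_itv/= leNgt usr.
pose f u := w u * fine (m1 `[c u, 0]%classic) - w u * fine (m2 `[c u, 0]%classic).
have intf : lebesgue.-integrable `[0, s[ (EFin \o f).
  apply: (@integrableS _ _ _ lebesgue `[0, s]%classic) => //.
    by move=> u/=; rewrite !in_itv/= => /andP[-> /ltW ->].
  have m0s' : measurable (`[0, s]%classic : set (measurableTypeR R)).
    exact: measurable_itv.
  have H := integrableB m0s' (int m1) (int m2).
  by apply: eq_integrable H => // u _; rewrite /= EFinB.
(* The endpoint s is dropped: there the charge of {0} would appear instead of 0. *)
rewrite -Rintegral_itv_bndo_bndc// -[RHS]Rintegral_itv_bndo_bndc; last first.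
  apply: eq_integrable intf => // u; rewrite inE => uI.
  by rewrite /= -dE.
by apply: eq_Rintegral => u; rewrite inE; exact: dE.
Qed.
End integration_by_parts.

(** * One-sided derivatives and primitives *)

Section derivative_on_segment.
Context {R : realType} {V : normedModType R} (a b : R).
Hypothesis ab : a < b.
Implicit Types (f : R -> V) (t : R).

(** Limits along this filter are unique only because [a, b] has more than one
    point. *)
Lemma within_dnbhs_proper t : t \in `[a, b] -> ProperFilter (within `[a, b] t^').
Proof.
rewrite in_itv/= => /andP[at_ tb]; apply: Build_ProperFilter_ex => P PF.
have /nbhs_ballP[d /= d0 H] : \forall s \near t, s != t -> `[a, b]%classic s -> P s.
  exact: PF.
have [tb'|bt] := ltP t b.
  pose s := Num.min b (t + d / 2).
  have ts : t < s by rewrite /s lt_min tb' ltrDl divr_gt0.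
  exists s; apply: H; last 2 first.
  - by rewrite gt_eqF.
  - by rewrite /= in_itv/= (le_trans at_ (ltW ts))/= /s ge_min lexx.
  rewrite /ball/= ltr0_norm ?subr_lt0// opprB ltrBlDl.
  rewrite /s gt_min; apply/orP; right; rewrite ltrD2l.
  by rewrite ltr_pdivrMr// ltr_pMr// ltr1n.
pose s := Num.max a (t - d / 2).
have st : s < t by rewrite /s gt_max (lt_le_trans ab bt)/= ltrBlDr ltrDl divr_gt0.
exists s; apply: H; last 2 first.
- by rewrite lt_eqF.
- by rewrite /= in_itv/= (le_trans (ltW st) tb) andbT /s le_max lexx.
rewrite /ball/= gtr0_norm ?subr_gt0// ltrBlDr -ltrBlDl.
rewrite /s lt_max; apply/orP; right; rewrite ltrD2l ltrN2.
by rewrite ltr_pdivrMr// ltr_pMr// ltr1n.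
Qed.

Lemma diff_quotientP f t l : diff_quotient_on a b f t --> l <->
  forall e, 0 < e -> exists2 d : R, 0 < d & forall s, s \in `[a, b] -> s != t ->
    `|s - t| < d -> `|l - (s - t)^-1 *: (f s - f t)| < e.
Proof.
rewrite /diff_quotient_on; split=> [/cvgrPdist_lt H e e0|H].
  have := H e e0; rewrite near_withinE /dnbhs near_withinE => /nbhs_ballP[d /= d0 Hd].
  by exists d => // s sI st std; apply: Hd => //; rewrite /ball/= distrC.
apply/cvgrPdist_lt => e e0; have [d d0 Hd] := H e e0.
rewrite near_withinE /dnbhs near_withinE; apply/nbhs_ballP.
exists d => //= s std st sI.
by apply: Hd => //; rewrite distrC.
Qed.

Lemma deriv_onP f t l : t \in `[a, b] -> diff_quotient_on a b f t --> l ->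
  derivable_on a b f t /\ deriv_on a b f t = l.
Proof.
move=> tI fl; have := within_dnbhs_proper tI => PF.
split; first by apply/cvg_ex; exists l.
by apply: cvg_lim => //; exact: norm_hausdorff.
Qed.

Lemma diff_quotient_lin f g k t l l' : diff_quotient_on a b f t --> l ->
  diff_quotient_on a b g t --> l' ->
  diff_quotient_on a b (fun s => f s + k *: g s) t --> l + k *: l'.
Proof.
move=> fl gl.
have H : (s - t)^-1 *: (f s - f t) + k *: ((s - t)^-1 *: (g s - g t))
    @[s --> within `[a, b] t^'] --> l + k *: l'.
  by apply: cvgD => //; apply: cvgZr.
rewrite /diff_quotient_on [X in X @ _ --> _](_ : _ = fun s =>
  (s - t)^-1 *: (f s - f t) + k *: ((s - t)^-1 *: (g s - g t)))//.
apply/funext => s; rewrite opprD addrACA -scalerBr scalerDr.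
by congr (_ + _); rewrite !scalerA mulrC.
Qed.

End derivative_on_segment.

Section primitive_C1.
Context {R : realType} (w : R -> R).
Hypothesis cw : continuous w.
Local Notation lebesgue := (@lebesgue_measure R).
Local Notation P := (primitive w).

Lemma continuous_itv_integrable (f : R -> R) (a b : R) : continuous f ->
  lebesgue.-integrable `[a, b] (EFin \o f).
Proof.
move=> cf; have [M fM] := continuous_bounded_itv a b cf.
apply: (@bounded_integrable _ _ _ lebesgue _ (measurable_itv _)
  (lebesgue_itvcc_lty a b) f M) => //.
by apply: measurable_funTS; exact: continuous_measurable_fun.
Qed.

Let increment_le s t c e : 0 <= s -> s <= t ->
  (forall u, s <= u <= t -> `|w u - c| <= e) ->
  `|P t - P s - c * (t - s)| <= e * (t - s).
Proof.
move=> s0; rewrite le_eqVlt => /orP[/eqP <-|st] wc.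
  by rewrite !subrr !mulr0 subrr normr0.
have iw := continuous_itv_integrable 0 t cw.
have i1 : lebesgue.-integrable `[s, t] (EFin \o w) by exact: continuous_itv_integrable.
have i2 : lebesgue.-integrable `[s, t] (EFin \o cst c).
  by apply: continuous_itv_integrable; exact: cst_continuous.
have m1 : measurable (`[s, t]%classic : set (measurableTypeR R)).
  exact: measurable_itv.
have l1 : fine (lebesgue `[s, t]%classic) = t - s.
  by rewrite lebesgue_measure_itv/= lte_fin st.
have -> : P t - P s = \int[lebesgue]_(u in `[s, t]) w u.
  rewrite /primitive Rintegral_itvB ?bnd_simp//; last exact: ltW.
  apply: Rintegral_itv_obnd_cbnd.
  by apply: integrableS i1 => // u/=; rewrite !in_itv/= => /andP[/ltW -> ->].
have -> : c * (t - s) = \int[lebesgue]_(u in `[s, t]) c.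
  by rewrite Rintegral_cst// l1.
rewrite -RintegralB// -l1.
apply: (@bounded_Rintegral_le _ _ _ lebesgue _ m1 (lebesgue_itvcc_lty s t)) => //.
apply: measurable_funTS; apply: continuous_measurable_fun => u.
by apply: cvgB; [exact: cw|exact: cvg_cst].
Qed.

(** With c = 0 this is the Lipschitz estimate for the primitive, and with c = w t
    it is its differentiability at t. *)
Lemma primitive_increment s t c e : 0 <= s -> 0 <= t ->
  (forall u, Num.min s t <= u <= Num.max s t -> `|w u - c| <= e) ->
  `|P t - P s - c * (t - s)| <= e * `|t - s|.
Proof.
move=> s0 t0; have [st|ts] := leP s t => wc.
  by rewrite [X in _ <= _ * X]ger0_norm ?subr_ge0// increment_le.
rewrite [X in _ <= _ * X]distrC [X in _ <= _ * X]ger0_norm ?subr_ge0 ?(ltW ts)//.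
have -> : `|P t - P s - c * (t - s)| = `|P s - P t - c * (s - t)|.
  by rewrite -normrN; congr (`|_|); ring.
by apply: increment_le => //; exact: ltW.
Qed.

Lemma primitive_max t : P t = P (Num.max 0 t).
Proof.
by have [t0|//] := leP t 0; rewrite !primitive_le0.
Qed.

Lemma primitive_within_continuous a b : {within `[a, b], continuous P}.
Proof.
have [M wM] := continuous_bounded_itv 0 (Num.max 0 b) cw.
have M1 : 0 < `|M| + 1 by rewrite ltr_wpDl.
apply/within_continuousP => s sI e e0; exists (e / (`|M| + 1)).
  by rewrite divr_gt0.
move=> t tI st.
rewrite primitive_max [P t]primitive_max.
set s' := Num.max 0 s; set t' := Num.max 0 t.
have s't' : `|s' - t'| <= `|s - t|.
  rewrite /s' /t'; have [s0|s0] := leP s 0; have [t0|t0] := leP t 0.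
  - by rewrite subrr normr0.
  - by rewrite sub0r normrN gtr0_norm// ltr0_norm; lra.
  - by rewrite subr0 gtr0_norm// gtr0_norm; lra.
  - by [].
have s'0 : 0 <= s' by rewrite /s' le_max lexx.
have t'0 : 0 <= t' by rewrite /t' le_max lexx.
have bI u : u <= b -> Num.max 0 u <= Num.max 0 b.
  by move=> ub; rewrite ge_max !le_max lexx ub orbT.
move: sI tI; rewrite !in_itv/= => /andP[_ sb] /andP[_ tb].
have := @primitive_increment t' s' 0 (`|M| + 1) t'0 s'0.
rewrite mul0r subr0 => H; apply: le_lt_trans (H _) _.
  move=> u /andP[u1 u2]; rewrite subr0; apply: (@le_trans _ _ M).
    apply: wM; rewrite in_itv/=; apply/andP; split.
      by apply: le_trans u1; rewrite le_min t'0.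
    by apply: le_trans u2 _; rewrite ge_max !bI.
  by apply: le_trans (ler_norm _) _; rewrite lerDl.
rewrite mulrC -ltr_pdivlMr//; exact: le_lt_trans st.
Qed.

Lemma primitive_diff_quotient T t : t \in `[0, T] ->
  diff_quotient_on 0 T P t --> w t.
Proof.
rewrite in_itv/= => /andP[t0 tT]; apply/diff_quotientP => e e0.
have e20 : 0 < e / 2 by rewrite divr_gt0.
have /cvgrPdist_lt/(_ _ e20)/nbhs_ballP[d /= d0 Hd] := @cw t.
exists d => // s; rewrite in_itv/= => /andP[s0 sT] st std.
have st0 : 0 < `|s - t| by rewrite normr_gt0 subr_eq0.
have H := @primitive_increment t s (w t) (e / 2) t0 s0.
rewrite -(ltr_pM2r st0) -normrM mulrBl /GRing.scale/= mulrAC mulVf ?subr_eq0// mul1r.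
rewrite distrC; apply: le_lt_trans (H _) _.
  move=> u /andP[u1 u2]; rewrite distrC; apply/ltW/Hd; rewrite /ball/=.
  apply: le_lt_trans std.
  move: u1 u2; have [ts|ts] := leP t s => u1 u2.
    by rewrite ler0_norm ?subr_le0// ger0_norm ?subr_ge0//; lra.
  by rewrite ger0_norm ?subr_ge0// ltr0_norm ?subr_lt0//; lra.
by rewrite ltr_pM2r//; lra.
Qed.

End primitive_C1.

(** * Coordinates, histories and compactness along a curve *)

Section coordinate_functionals.
Context {R : realType} (n : nat).
Local Notation V := 'rV[R]_n.

Lemma dual_basis_vecE (k : 'I_n) (v : V) : dual_basis_vec k v = v 0 k.
Proof.
rewrite /dual_basis_vec (@toDual_bounded _ _ (fun v : V => v 0 k) 1)//.
  by move=> c u u'; rewrite !mxE.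
move=> u; rewrite mul1r /Num.norm/= mx_normrE.
exact: (le_bigmax _ (fun ij => `|u ij.1 ij.2|) (0, k)).
Qed.

Lemma dual_basis_vec_basis (j k : 'I_n) :
  dual_basis_vec j (basis_vec k : V) = (j == k)%:R.
Proof. by rewrite dual_basis_vecE mxE eqxx. Qed.

Let dual_sumE (f : 'I_n -> dual V) v : (\sum_(k < n) f k) v = \sum_(k < n) f k v.
Proof. by elim/big_ind2 : _ => // f1 u1 f2 u2 <- <-. Qed.

Lemma dual_basis_expansion (p : dual V) :
  p = \sum_(k < n) p (basis_vec k) *: dual_basis_vec k.
Proof.
apply: dualP => v.
rewrite dual_sumE {1}[v]row_sum_delta dual_arg_sum.
apply: eq_bigr => k _.
rewrite dual_argZ mulrC [RHS](_ : _ = p (basis_vec k) * dual_basis_vec k v)//.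
by rewrite dual_basis_vecE.
Qed.

Lemma dual_basis_sumE (c : 'I_n -> R) (k : 'I_n) :
  (\sum_(j < n) c j *: dual_basis_vec j) (basis_vec k) = c k.
Proof.
rewrite dual_sumE (bigD1 k)//= big1 ?addr0.
  rewrite [LHS](_ : _ = c k * dual_basis_vec k (basis_vec k))//.
  by rewrite dual_basis_vec_basis eqxx mulr1.
move=> j jk; rewrite [LHS](_ : _ = c j * dual_basis_vec j (basis_vec k))//.
by rewrite dual_basis_vec_basis (negbTE jk) mulr0.
Qed.

End coordinate_functionals.

Section embedding.
Context {R : realType} (n : nat) (r : R) (k : 'I_n).
Local Notation H := (C0 (- r) 0 'rV[R]_n).
Local Notation H1 := (C0 (- r) 0 R).
Implicit Types (phi : H1) (L : dual H).

Definition C0embed phi : H := toC0 (- r) 0 (fun t => phi t *: basis_vec k).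

(** The functional whose representation is the k-th coordinate of rieszn L. *)
Definition coordinate L : dual H1 := toDual (fun phi : H1 => L (C0embed phi)).

Lemma C0embedE phi t : t \in `[- r, 0] -> C0embed phi t = phi t *: basis_vec k.
Proof.
move=> tI; rewrite toC0E//.
apply: (@within_continuous_le _ _ _ _ _ `|basis_vec k : 'rV[R]_n| _ _
  (@C0_within_continuous _ _ _ _ phi)) => u v _ _.
by rewrite -scalerBl normrZ mulrC.
Qed.

Lemma C0embed_lin c phi phi' :
  C0embed (c *: phi + phi') = c *: C0embed phi + C0embed phi'.
Proof.
apply: C0P => t tI; rewrite C0D C0Z !C0embedE//.
by rewrite [X in X *: _](_ : _ = c * phi t + phi' t)// scalerDl scalerA.
Qed.

Lemma C0embed_norm phi : `|C0embed phi| <= `|phi| * `|basis_vec k : 'rV[R]_n|.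
Proof.
apply: C0_norm_le_in => [|t tI]; first by rewrite mulr_ge0.
by rewrite C0embedE// normrZ ler_wpM2r// C0_norm_ub_in.
Qed.

Lemma coordinateE L phi : coordinate L phi = L (C0embed phi).
Proof.
rewrite /coordinate (@toDual_bounded _ _ _ (`|L| * `|basis_vec k : 'rV[R]_n|))//.
  by move=> c u v; rewrite /= C0embed_lin dual_argD dual_argZ.
move=> u; apply: le_trans (dual_le _ _) _; rewrite -mulrA ler_wpM2l// mulrC.
exact: C0embed_norm.
Qed.

Lemma coordinate_lip L L' :
  `|coordinate L - coordinate L'| <= `|L - L'| * `|basis_vec k : 'rV[R]_n|.
Proof.
apply: dual_norm_le => phi phi1.
rewrite [X in `|X|](_ : _ = coordinate L phi - coordinate L' phi)//.
rewrite !coordinateE [X in `|X|](_ : _ = (L - L') (C0embed phi))//.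
apply: le_trans (dual_le _ _) _; rewrite ler_wpM2l//.
by apply: le_trans (C0embed_norm _) _; rewrite ler_piMl.
Qed.

Lemma coordinate_continuous (L : R -> dual H) a b :
  {within `[a, b], continuous L} ->
  {within `[a, b], continuous (fun t => coordinate (L t))}.
Proof.
move=> cL; apply: (within_continuous_le (C := `|basis_vec k : 'rV[R]_n|) cL).
by move=> s t _ _; rewrite mulrC coordinate_lip.
Qed.

Lemma rieszn_basis L t : rieszn L t (basis_vec k) = riesz1 (coordinate L) t.
Proof. by rewrite /rieszn dual_basis_sumE. Qed.

End embedding.

Section histories.
Context {R : realType} (n : nat) (r T : R).
Local Notation H := (C0 (- r) 0 'rV[R]_n).
Local Notation Z := (C0 (- r) T 'rV[R]_n).
Implicit Types (x h : Z) (t : R).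

Let shift_in t theta : t \in `[0, T] -> theta \in `[- r, 0] -> t + theta \in `[- r, T].
Proof.
by rewrite !in_itv/= => /andP[? ?] /andP[? ?]; apply/andP; split; lra.
Qed.

Lemma historyE x t theta : t \in `[0, T] -> theta \in `[- r, 0] ->
  history x t theta = x (t + theta).
Proof.
move=> tI thI; rewrite toC0E//; apply/within_continuousP => s sI e e0.
have /within_continuousP/(_ _ (shift_in tI sI) e e0)[d d0 Hd] :=
  @C0_within_continuous _ _ _ _ x.
by exists d => // u uI su; apply: Hd; rewrite ?shift_in// opprD addrACA subrr add0r.
Qed.

Lemma history_lin x h k t : t \in `[0, T] ->
  history (x + k *: h) t = history x t + k *: history h t.
Proof.
move=> tI; apply: C0P => u uI; rewrite C0D C0Z !historyE//.
Qed.

Lemma history_continuous x : {within `[0, T], continuous (history x)}.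
Proof.
apply/within_continuousP => s sI e e0.
have e20 : 0 < e / 2 by rewrite divr_gt0.
have [d d0 Hd] := uniformly_continuous_segment (@C0_within_continuous _ _ _ _ x) e20.
exists d => // t tI st; apply: (@le_lt_trans _ _ (e / 2)); last by lra.
apply: C0_norm_le_in => [|u uI]; first exact: ltW.
rewrite [X in `|X|](_ : _ = history x s u - history x t u)// !historyE//.
by rewrite ltW// Hd ?shift_in// opprD addrACA subrr addr0.
Qed.

End histories.

Section uniform_continuity_along_a_curve.
Context {R : realType} {V1 V2 W : normedModType R} (T : R).
Variable Phi : R * V1 * V2 -> W.
Hypothesis cPhi : {within [set p | p.1.1 \in `[0, T]], continuous Phi}.
Variables (g : R -> V1) (v : R -> V2).
Hypotheses (cg : {within `[0, T], continuous g}) (cv : {within `[0, T], continuous v}).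

Let local t e : t \in `[0, T] -> 0 < e -> exists2 d : R, 0 < d &
  forall t' phi v', t' \in `[0, T] -> `|t - t'| < d -> `|g t - phi| < d ->
    `|v t - v'| < d -> `|Phi (t, g t, v t) - Phi (t', phi, v')| < e.
Proof.
move=> tI e0.
have /subspace_continuousP/(_ (t, g t, v t) tI)/cvgrPdist_lt/(_ e e0) := cPhi.
rewrite near_withinE => /nbhs_ballP[d /= d0 Hd]; exists d => // t' phi v' t'I tt' gp vv.
by apply: Hd => //; split; [split|]; rewrite /= -ball_normE.
Qed.

(** The neighbourhood of the curve on which Phi is close to its values along the
    curve has a uniform width, by compactness of [0, T]. *)
Lemma uniform_along_curve e : 0 < e -> exists2 d : R, 0 < d &
  forall t phi v', t \in `[0, T] -> `|g t - phi| < d -> `|v t - v'| < d ->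
    `|Phi (t, g t, v t) - Phi (t, phi, v')| < e.
Proof.
move=> e0; have e20 : 0 < e / 2 by rewrite divr_gt0.
have /compact_near_coveringP/near_covering_withinP H := @segment_compact R 0 T.
have {}H : \forall d \near 0^'+, `[0, T]%classic `<=` (fun t => forall phi v',
    `|g t - phi| < d -> `|v t - v'| < d ->
    `|Phi (t, g t, v t) - Phi (t, phi, v')| < e).
  apply: H => t tI; have [d d0 Hd] := local tI e20.
  have d20 : 0 < d / 2 by rewrite divr_gt0.
  have /within_continuousP/(_ _ tI _ d20)[d1 d10 Hd1] := cg.
  have /within_continuousP/(_ _ tI _ d20)[d2 d20' Hd2] := cv.
  near=> s h => /= sI phi v' sp sv.
  have hd : h < d / 2 by near: h; exact: nbhs_right_lt.
  have ts : `|t - s| < d / 2 by near: s; exact: nbhsx_ballx.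
  have gs : `|g t - g s| < d / 2 by apply: Hd1 => //; near: s; exact: nbhsx_ballx.
  have vs : `|v t - v s| < d / 2 by apply: Hd2 => //; near: s; exact: nbhsx_ballx.
  rewrite (splitr e); apply: le_lt_trans (ler_distD (Phi (t, g t, v t)) _ _) _.
  apply: ltrD; first by rewrite distrC; apply: Hd => //; lra.
  apply: Hd; [by []|lra| |].
    by apply: le_lt_trans (ler_distD (g s) _ _) _; lra.
  by apply: le_lt_trans (ler_distD (v s) _ _) _; lra.
near (0 : R)^'+ => d; exists d => // t phi v' tI; exact: (near H d).
Unshelve. all: by end_near. Qed.

Lemma continuous_along_curve : {within `[0, T], continuous (fun t => Phi (t, g t, v t))}.
Proof.
apply/within_continuousP => t tI e e0; have [d d0 Hd] := local tI e0.
have /within_continuousP/(_ _ tI _ d0)[d1 d10 Hd1] := cg.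
have /within_continuousP/(_ _ tI _ d0)[d2 d20 Hd2] := cv.
exists (Num.min d (Num.min d1 d2)); first by rewrite !lt_min d0 d10 d20.
move=> s sI; rewrite !lt_min => /and3P[h h1 h2].
by apply: Hd => //; [exact: Hd1|exact: Hd2].
Qed.

End uniform_continuity_along_a_curve.

(** * The first variation *)

Section directional_mean_value.
Context {R : realType} {V : normedModType R}.
Variable f : V -> R.
Hypothesis df : forall u, differentiable f u.

Lemma toDual_diff u z : toDual ('d f u) z = 'd f u z.
Proof.
rewrite toDualE//; first by move=> c a b; rewrite linearP.
exact: (diff_continuous (df u)).
Qed.

(** On the line through u in the direction z, f is a function of one real variable
    whose derivative is the differential of f at z. *)
Lemma directional_MVT u z (lam : R) : 0 < lam ->
  exists2 c, 0 < c < lam &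
    f (u + lam *: z) - f u = lam * toDual ('d f (u + c *: z)) z.
Proof.
move=> lam0; pose G a := f (u + a *: z).
have dG (c : R) : is_derive c (1 : R) G ('d f (u + c *: z) z).
  have E : (fun h : R => h^-1 *: (G (h *: 1 + c) - G c)) =
      fun h : R => h^-1 *: (f (h *: z + (u + c *: z)) - f (u + c *: z)).
    apply/funext => h; rewrite /G; congr (_ *: (f _ - _)).
    by rewrite [h *: 1]mulr1 scalerDl addrCA.
  have dz : derivable f (u + c *: z) z by exact: diff_derivable.
  apply: DeriveDef; first by rewrite /derivable E.
  by rewrite /derive E -deriveE.
have [c cI H] : exists2 c, c \in `]0, lam[ &
    G lam - G 0 = 'd f (u + c *: z) z * (lam - 0).
  apply: (@MVT R G (fun c => 'd f (u + c *: z) z)) => //.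
  by apply: derivable_within_continuous => c _; case: (dG c).
exists c; first by move: cI; rewrite in_itv.
by move: H; rewrite /G scale0r addr0 subr0 mulrC => ->; rewrite toDual_diff.
Qed.

End directional_mean_value.

Lemma cvg_dual_eval {R : realType} {W : normedModType R} {X : Type}
    (F : set_system X) {FF : Filter F} (L : X -> dual W) (g : X -> W)
    (L0 : dual W) (g0 : W) :
  L @ F --> L0 -> g @ F --> g0 -> (L t (g t) : R) @[t --> F] --> (L0 g0 : R).
Proof.
move=> cL cg; apply: (@cvg_trans _ ((L0 (g t) + (L t - L0) (g t) : R) @[t --> F])).
  apply: near_eq_cvg; near=> t.
  by rewrite [X in _ + X](_ : _ = L t (g t) - L0 (g t))// addrC subrK.
rewrite -(addr0 (L0 g0)); apply: cvgD.
  by apply: (cvg_comp _ _ cg); exact: dual_continuous.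
apply/norm_cvg0P.
have H : `|L t - L0| * `|g t| @[t --> F] --> (0 : R).
  rewrite -(mul0r `|g0|); apply: cvgM; last exact: cvg_norm.
  rewrite -(normr0 (dual W)) -(subrr L0); apply: cvg_norm.
  by apply: cvgB => //; exact: cvg_cst.
apply: (squeeze_cvgr _ (cvg_cst 0) H); near=> t.
by rewrite normr_ge0 dual_le.
Unshelve. all: by end_near. Qed.

Section within_continuous_operations.
Context {R : realType} (a b : R).

Lemma within_continuous_eq {W : normedModType R} (f g : R -> W) :
  (forall t, t \in `[a, b] -> f t = g t) ->
  {within `[a, b], continuous f} -> {within `[a, b], continuous g}.
Proof.
move=> fg cf; apply: (within_continuous_le (C := 1) cf) => s t sI tI.
by rewrite mul1r !fg.
Qed.

Lemma within_continuous_lin {W : normedModType R} (f g : R -> W) (k : R) :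
  {within `[a, b], continuous f} -> {within `[a, b], continuous g} ->
  {within `[a, b], continuous (fun t => f t + k *: g t)}.
Proof.
move=> cf cg x.
have ckg : {for x, continuous (fun y : subspace `[a, b] => k *: g y)}.
  exact: (@continuousZr _ W (subspace `[a, b]) g k x (cg x)).
exact: (@continuousD _ W (subspace `[a, b]) _ _ x (cf x) ckg).
Qed.

Lemma within_continuous_eval {W : normedModType R} (L : R -> dual W) (g : R -> W) :
  {within `[a, b], continuous L} -> {within `[a, b], continuous g} ->
  {within `[a, b], continuous (fun t => L t (g t) : R)}.
Proof.
move=> /subspace_continuousP cL /subspace_continuousP cg.
apply/subspace_continuousP => t tI.
by apply: cvg_dual_eval; [exact: cL|exact: cg].
Qed.

Lemma within_continuous_integrable (f : R -> R) : {within `[a, b], continuous f} ->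
  (@lebesgue_measure R).-integrable `[a, b] (EFin \o f).
Proof.
by move=> cf; apply: continuous_compact_integrable => //; exact: segment_compact.
Qed.

End within_continuous_operations.

Section first_variation.
Context {R : realType} (n : nat) (r T : R).
Hypotheses (r0 : 0 < r) (rT : r < T).
Local Notation V := 'rV[R]_n.
Local Notation H := (C0 (- r) 0 V).
Local Notation Z := (C0 (- r) T V).
Local Notation lebesgue := (@lebesgue_measure R).
Variable F : R -> H -> V -> R.
Hypotheses (F1 : A1 T F) (F2 : A2 T F) (F3 : A3 T F).
Variables (psi : H) (zeta : V) (x : Z).
Hypothesis xsol : local_solution F psi zeta x.

Let T0 : 0 < T. Proof. exact: lt_trans rT. Qed.

Let xC1 : C1_on 0 T x. Proof. by case: xsol => [[]]. Qed.

Local Notation dt := (deriv_on 0 T).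

Let deriv_lin (y h : Z) k t : C1_on 0 T y -> C1_on 0 T h -> t \in `[0, T] ->
  derivable_on 0 T (y + k *: h : Z) t /\ dt (y + k *: h : Z) t = dt y t + k *: dt h t.
Proof.
move=> [yd _] [hd _] tI; apply: deriv_onP => //.
rewrite (_ : C0_fun (y + k *: h) = fun s => y s + k *: h s)//.
by apply: diff_quotient_lin; [exact: (yd t tI)|exact: (hd t tI)].
Qed.

Let C1_lin (y h : Z) k : C1_on 0 T y -> C1_on 0 T h -> C1_on 0 T (y + k *: h : Z).
Proof.
move=> yC hC; split=> [t tI|]; first by case: (deriv_lin k yC hC tI).
apply: (@within_continuous_eq _ _ _ _ (fun t => dt y t + k *: dt h t)).
  by move=> t tI; case: (deriv_lin k yC hC tI).
by apply: within_continuous_lin; [case: yC|case: hC].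
Qed.

Let deriv_0 t : t \in `[0, T] -> derivable_on 0 T (0 : Z) t /\ dt (0 : Z) t = 0.
Proof.
move=> tI; apply: deriv_onP => //; rewrite /diff_quotient_on.
rewrite [X in X @ _ --> _](_ : _ = cst 0); first exact: cvg_cst.
by apply/funext => s; rewrite !C00 subrr scaler0.
Qed.

Let C1_0 : C1_on 0 T (0 : Z).
Proof.
split=> [t /deriv_0[]//|].
apply: (@within_continuous_eq _ _ _ _ (cst 0)) => [t /deriv_0[_ ->]//|].
by apply: continuous_subspaceT => s; exact: cvg_cst.
Qed.

Definition D2_along t : dual H := D2 F t (history x t) (dt x t).
Definition D3_along t : dual V := D3 F t (history x t) (dt x t).

Lemma D2_along_continuous : {within `[0, T], continuous D2_along}.
Proof.
apply: (@continuous_along_curve _ _ _ _ T (fun p => D2 F p.1.1 p.1.2 p.2) F2.2).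
  exact: history_continuous.
by case: xC1.
Qed.

Lemma D3_along_continuous : {within `[0, T], continuous D3_along}.
Proof.
apply: (@continuous_along_curve _ _ _ _ T (fun p => D3 F p.1.1 p.1.2 p.2) F3.2).
  exact: history_continuous.
by case: xC1.
Qed.

Definition variation (h : Z) t : R :=
  D2_along t (history h t) + D3_along t (dt h t).

Section one_direction.
Variable h : Z.
Hypotheses (hC1 : C1_on 0 T h) (h0 : history h 0 = 0) (hT : h T = 0).

Local Notation Q := (variation h).

Lemma variation_continuous : {within `[0, T], continuous Q}.
Proof.
have := @within_continuous_lin _ 0 T R _ _ 1
  (within_continuous_eval D2_along_continuous (@history_continuous _ _ r T h))
  (within_continuous_eval D3_along_continuous hC1.2).
by apply: within_continuous_eq => t tI; rewrite /variation scale1r.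
Qed.

Let quotient lam t := lam^-1 *
  (F t (history (x + lam *: h) t) (dt (x + lam *: h : Z) t) - F t (history x t) (dt x t)).

Let dth_bound : exists2 M : R, 0 < M & forall t, t \in `[0, T] -> `|dt h t| <= M.
Proof.
have /compact_bounded[M [_ HM]] :=
  continuous_compact hC1.2 (@segment_compact _ 0 T).
exists (`|M| + 1) => [|t tI]; first by rewrite ltr_wpDl.
by apply: (HM (`|M| + 1)); [rewrite (le_lt_trans (ler_norm M))// ltrDl|exists t].
Qed.

Let history_norm t : t \in `[0, T] -> `|history h t| <= `|h|.
Proof.
move=> tI; apply: C0_norm_le_in => // u uI; rewrite historyE// C0_norm_ub_in//.
by move: tI uI; rewrite !in_itv/= => /andP[? ?] /andP[? ?]; apply/andP; split; lra.
Qed.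

(** The increments in the two variables are treated one after the other by the
    mean value theorem, so that only the partial differentials are involved; the
    convergence is uniform in t by compactness. *)
Let quotient_cvg e : 0 < e -> exists2 d : R, 0 < d & forall lam t, 0 < lam < d ->
  t \in `[0, T] -> `|quotient lam t - Q t| <= e.
Proof.
move=> e0; have [M M0 hM] := dth_bound.
have B0 : 0 < `|h| + M by rewrite ltr_wpDl.
(* The direction (h_t, h' t) has norm at most `|h| + M. *)
pose e' := e / (`|h| + M).
have e'0 : 0 < e' by rewrite divr_gt0.
have [d1 d10 H1] := uniform_along_curve (Phi := fun p => D2 F p.1.1 p.1.2 p.2)
  F2.2 (@history_continuous _ _ r T x) xC1.2 e'0.
have [d2 d20 H2] := uniform_along_curve (Phi := fun p => D3 F p.1.1 p.1.2 p.2)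
  F3.2 (@history_continuous _ _ r T x) xC1.2 e'0.
exists (Num.min d1 d2 / (`|h| + M)); first by rewrite divr_gt0// lt_min d10.
move=> lam t /andP[lam0]; rewrite ltr_pdivlMr// lt_min => /andP[lamd1 lamd2] tI.
have small1 c z : 0 <= c <= lam -> `|z| <= `|h| + M -> c * `|z| < d1.
  move=> /andP[c0 cl] zB; apply: le_lt_trans lamd1.
  by apply: ler_pM.
have small2 c z : 0 <= c <= lam -> `|z| <= `|h| + M -> c * `|z| < d2.
  move=> /andP[c0 cl] zB; apply: le_lt_trans lamd2.
  by apply: ler_pM.
have etaB : `|history h t| <= `|h| + M.
  by apply: le_trans (history_norm tI) _; rewrite lerDl ltW.
have wB : `|dt h t| <= `|h| + M by apply: le_trans (hM _ tI) _; rewrite lerDr.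
rewrite /quotient history_lin// (deriv_lin lam xC1 hC1 tI).2.
set phi := history x t; set eta := history h t; set v := dt x t; set w := dt h t.
have [c1 /andP[c10 c1l] E1] := directional_MVT
  (fun u => F2.1 t u (v + lam *: w) tI) phi eta lam0.
have [c2 /andP[c20 c2l] E2] := directional_MVT (fun u => F3.1 t phi u tI) v w lam0.
rewrite -[X in _ * X](subrKA (F t phi (v + lam *: w))) E1 E2 -mulrDr mulKf ?gt_eqF//.
rewrite /variation opprD addrACA.
have lamI : 0 <= lam <= lam by rewrite lexx ltW.
have c1I : 0 <= c1 <= lam by rewrite !ltW.
have c2I : 0 <= c2 <= lam by rewrite !ltW.
have -> : e = e' * (`|h| + M) by rewrite /e' divfK// gt_eqF.
rewrite mulrDr; apply: le_trans (ler_normD _ _) _; apply: lerD.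
- rewrite [X in `|X|](_ : _ =
    (D2 F t (phi + c1 *: eta) (v + lam *: w) - D2_along t) eta)//.
  apply: le_trans (dual_le _ _) _; apply: ler_pM => //; last exact: history_norm.
  rewrite distrC ltW//; apply: (H1 t (phi + c1 *: eta) (v + lam *: w) tI).
    by rewrite opprD addNKr normrN normrZ ger0_norm ?(ltW c10)// small1.
  by rewrite opprD addNKr normrN normrZ ger0_norm ?(ltW lam0)// small1.
- rewrite [X in `|X|](_ : _ = (D3 F t phi (v + c2 *: w) - D3_along t) w)//.
  apply: le_trans (dual_le _ _) _; apply: ler_pM => //; last exact: hM.
  rewrite distrC ltW//; apply: (H2 t phi (v + c2 *: w) tI).
    by rewrite subrr normr0.
  by rewrite opprD addNKr normrN normrZ ger0_norm ?(ltW c20)// small2.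
Qed.

Let F_integrable (y : Z) : C1_on 0 T y ->
  lebesgue.-integrable `[0, T] (EFin \o (fun t => F t (history y t) (dt y t))).
Proof.
move=> yC; apply: within_continuous_integrable.
apply: (@continuous_along_curve _ _ _ _ T (fun p => F p.1.1 p.1.2 p.2) F1).
  exact: history_continuous.
exact: yC.2.
Qed.

Let quotient_integrable lam :
  lebesgue.-integrable `[0, T] (EFin \o quotient lam).
Proof.
have m0T : measurable (`[0, T]%classic : set (measurableTypeR R)).
  exact: measurable_itv.
have H := integrableZl m0T lam^-1
  (integrableB m0T (F_integrable (C1_lin lam xC1 hC1)) (F_integrable xC1)).
by apply: eq_integrable H => // t _; rewrite /= EFinM EFinB.
Qed.

Let quotient_ge0 : exists2 d : R, 0 < d & forall lam, 0 < lam < d ->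
  0 <= \int[lebesgue]_(t in `[0, T]) quotient lam t.
Proof.
have [[_ x0 xT] [eps eps0 xmin]] := xsol; have [M M0 hM] := dth_bound.
have B0 : 0 < `|h| + M by rewrite ltr_wpDl.
have m0T : measurable (`[0, T]%classic : set (measurableTypeR R)).
  exact: measurable_itv.
have TI : 0 \in `[0, T] by rewrite in_itv/= lexx ltW.
exists (eps / (`|h| + M)) => [|lam /andP[lam0]]; first by rewrite divr_gt0.
rewrite ltr_pdivlMr// => lamB.
have yadm : admissible psi zeta (x + lam *: h).
  split; first exact: (C1_lin lam xC1 hC1).
    by rewrite history_lin// h0 scaler0 addr0.
  by rewrite C0D C0Z hT scaler0 addr0.
have ynorm : X_norm (x + lam *: h - x) < eps.
  rewrite (_ : x + lam *: h - x = 0 + lam *: h); last by rewrite add0r addrC addKr.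
  apply: le_lt_trans lamB; rewrite /X_norm mulrDr; apply: lerD.
    by rewrite add0r normrZ gtr0_norm.
  apply: ge_sup; first by exists `|dt (0 + lam *: h : Z) 0|, 0.
  move=> _ [t tI <-]; rewrite (deriv_lin lam C1_0 hC1 tI).2 (deriv_0 tI).2 add0r.
  by rewrite normrZ gtr0_norm// ler_wpM2l ?hM// ltW.
have := xmin _ yadm ynorm; rewrite -subr_ge0 /J -RintegralB//; last 2 first.
- exact: F_integrable (C1_lin lam xC1 hC1).
- exact: (F_integrable xC1).
move=> J0; rewrite RintegralZl//; first by rewrite mulr_ge0// invr_ge0 ltW.
have H := integrableB m0T (F_integrable (C1_lin lam xC1 hC1)) (F_integrable xC1).
by apply: eq_integrable H => // t _; rewrite /= EFinB.
Qed.

(** The quotients have nonnegative integrals because x is a local minimum, and they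
    converge uniformly to the variation. *)
Lemma first_variation_ge0 : 0 <= \int[lebesgue]_(t in `[0, T]) Q t.
Proof.
have m0T : measurable (`[0, T]%classic : set (measurableTypeR R)).
  exact: measurable_itv.
have lT : fine (lebesgue `[0, T]%classic) = T.
  by rewrite lebesgue_measure_itv/= lte_fin T0 /= subr0.
apply/ler_addgt0Pr => e e0.
have eT : 0 < e / T by rewrite divr_gt0.
have [d1 d10 H1] := quotient_cvg eT; have [d2 d20 H2] := quotient_ge0.
pose lam := Num.min d1 d2 / 2.
have lam0 : 0 < lam by rewrite divr_gt0// lt_min d10.
have lamd : lam < d1 /\ lam < d2.
  by rewrite /lam; have [|] := leP d1 d2; lra.
apply: le_trans (H2 lam _) _; first by rewrite lam0 lamd.2.
have -> : e = \int[lebesgue]_(t in `[0, T]) (e / T).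
  by rewrite Rintegral_cst// lT divfK// gt_eqF.
have cint : lebesgue.-integrable `[0, T] (EFin \o cst (e / T)).
  by apply: continuous_itv_integrable; exact: cst_continuous.
have Qint := within_continuous_integrable variation_continuous.
rewrite -RintegralD//; apply: le_Rintegral => //.
  by apply: eq_integrable (integrableD m0T Qint cint) => // t _; rewrite /= EFinD.
move=> t tI; have := H1 lam t; rewrite lam0 lamd.1 => /(_ isT tI).
by rewrite ler_distl => /andP[].
Qed.

End one_direction.
(** The variation is linear in the direction, so h and - h give equality. *)
Lemma first_variation (h : Z) : C1_on 0 T h -> history h 0 = 0 -> h T = 0 ->
  \int[lebesgue]_(t in `[0, T]) variation h t = 0.
Proof.
move=> hC hh0 hT; apply/eqP; rewrite eq_le first_variation_ge0// andbT.
have nC : C1_on 0 T (0 + (-1) *: h : Z) by exact: (C1_lin (-1) C1_0 hC).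
have hN t : t \in `[0, T] -> history (0 + (-1) *: h) t = (-1) *: history h t.
  move=> tI; apply: C0P => u uI; rewrite C0Z !historyE//.
  by rewrite C0D C0Z C00 add0r.
have nE t : t \in `[0, T] -> variation (0 + (-1) *: h) t = -1 * variation h t.
  move=> tI; rewrite /variation hN// (deriv_lin (-1) C1_0 hC tI).2 (deriv_0 tI).2.
  by rewrite add0r !dual_argZ mulrDr.
have TI : 0 \in `[0, T] by rewrite in_itv/= lexx ltW.
have E : \int[lebesgue]_(t in `[0, T]) variation (0 + (-1) *: h) t =
    \int[lebesgue]_(t in `[0, T]) (-1 * variation h t).
  by apply: eq_Rintegral => t /set_mem; exact: nE.
have := first_variation_ge0 nC; rewrite E hN// hh0 scaler0.
move=> /(_ erefl); rewrite C0D C0Z C00 hT scaler0 addr0 => /(_ erefl).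
rewrite RintegralZl//; first by rewrite mulN1r oppr_ge0.
exact: within_continuous_integrable (variation_continuous hC).
Qed.

End first_variation.

(** * The memory term and du Bois-Reymond's lemma *)

Section translation.
Context {R : realType}.
Local Notation lebesgue := (@lebesgue_measure R).

Lemma lebesgue_translation (d : R) (A : set R) : measurable A ->
  pushforward lebesgue (fun t : measurableTypeR R => t + d : measurableTypeR R) A =
  lebesgue A.
Proof.
move=> mA; have md : measurable_fun setT
    (fun t : measurableTypeR R => t + d : measurableTypeR R).
  by apply: measurable_funD.
apply/esym/lebesgue_measure_unique => //= _ [[a b]] _ <-; rewrite /pushforward.
rewrite (_ : _ @^-1` _ = `]a - d, b - d]%classic); last first.
  by apply/seteqP; split => x /=; rewrite !in_itv/= ltrBlDr lerBrDr.
rewrite !lebesgue_measure_itv/= !lte_fin ltrD2r.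
by case: ifP => // _; rewrite -!EFinB; congr EFin; ring.
Qed.

Lemma Rintegral_translation (f : R -> R) (a b d M : R) :
  measurable_fun `[a + d, b + d] f ->
  (forall t, t \in `[a + d, b + d] -> `|f t| <= M) ->
  \int[lebesgue]_(t in `[a + d, b + d]) f t = \int[lebesgue]_(t in `[a, b]) f (t + d).
Proof.
move=> mf fM.
have md : measurable_fun setT (fun t : R => t + d) by apply: measurable_funD.
have mI : measurable (`[a + d, b + d]%classic : set R) by exact: measurable_itv.
have preI : (fun t => t + d) @^-1` `[a + d, b + d]%classic = `[a, b]%classic.
  by apply/seteqP; split => x /=; rewrite !in_itv/= !lerD2r.
pose g := f \_ `[a + d, b + d].
have mg : measurable_fun setT g.
  by apply/(measurable_restrict _ mI measurableT); rewrite setTI.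
have gE t : t \in `[a + d, b + d] -> g t = f t.
  by move=> tI; rewrite /g patchE mem_setE tI.
transitivity (\int[lebesgue]_(t in `[a + d, b + d]) g t).
  by apply: eq_Rintegral => t; rewrite inE => tI; rewrite gE.
transitivity (\int[lebesgue]_(t in `[a, b]) g (t + d)); last first.
  apply: eq_Rintegral => t; rewrite inE/= in_itv/= => /andP[h1 h2].
  by rewrite gE// in_itv/= !lerD2r h1.
rewrite /Rintegral; congr fine.
pose phi (t : measurableTypeR R) : measurableTypeR R := t + d.
have mphi : measurable_fun setT phi by apply: measurable_funD.
transitivity (\int[pushforward lebesgue phi]_(t in `[(a + d)%R, (b + d)%R]) (g t)%:E)%E.
  by apply: eq_measure_integral => //= A mA _; exact/esym/lebesgue_translation.
rewrite integral_pushforward//; last 2 first.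
- exact/measurable_EFinP.
- rewrite preI; apply: (@bounded_integrable _ _ _ lebesgue _ (measurable_itv _)
    (lebesgue_itvcc_lty a b) (g \o (fun t => t + d)) M).
    by apply: measurable_funTS; exact: measurableT_comp.
  move=> t; rewrite /= in_itv/= => /andP[h1 h2].
  by rewrite gE ?fM// in_itv/= !lerD2r h1.
by rewrite preI.
Qed.

End translation.

Section memory_kernel.
Context {R : realType} (r T : R).
Hypotheses (r0 : 0 < r) (T0 : 0 < T).
Local Notation H1 := (C0 (- r) 0 R).
Local Notation lebesgue := (@lebesgue_measure R).
Local Notation D := (`[0, T]%classic : set R).
Variable l : R -> dual H1.
Hypothesis cl : {within `[0, T], continuous l}.

Definition mass t : R := l t (C0one r).

(** For theta < 0 this is the mass that the charge of l t puts on [theta, 0]. *)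
Definition tail t theta : R := mass t - riesz1 (l t) theta.

Let l_bound : exists2 M : R, 0 <= M & forall t, t \in `[0, T] -> `|l t| <= M.
Proof.
have /compact_bounded[M [_ HM]] := continuous_compact cl (@segment_compact _ 0 T).
exists (`|M| + 1) => [|t tI]; first by rewrite addr_ge0.
by apply: (HM (`|M| + 1)); [rewrite (le_lt_trans (ler_norm M))// ltrDl|exists t].
Qed.

Lemma tail0 t : tail t 0 = 0.
Proof. by rewrite /tail riesz1_0// subrr. Qed.

Lemma tail_lip t s theta : `|tail t theta - tail s theta| <= 2 * `|l t - l s|.
Proof.
have -> : tail t theta - tail s theta = (mass t - mass s) -
    (riesz1 (l t) theta - riesz1 (l s) theta) by rewrite /tail; ring.
rewrite mulr2n mulrDl mul1r (le_trans (ler_normB _ _))// lerD ?riesz1_lip//.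
rewrite [X in `|X|](_ : _ = (l t - l s) (C0one r))//.
by apply: le_trans (dual_le _ _) _; rewrite ler_piMr ?C0one_norm.
Qed.

Lemma tail_bound : exists2 M : R, 0 <= M &
  forall t theta, t \in `[0, T] -> `|tail t theta| <= M.
Proof.
have [M M0 HM] := l_bound; exists (M + M) => [|t theta tI]; first by rewrite addr_ge0.
apply: le_trans (ler_normB _ _) _; apply: lerD; last first.
  by apply: le_trans (riesz1_bound _ _ _) _ => //; exact: HM.
apply: le_trans (dual_le _ _) _.
by rewrite (le_trans _ (HM _ tI))// ler_piMr ?C0one_norm.
Qed.

(** For u < t, tail t (u - t) is a limit of expressions in ramps that are continuous
    in t and in u; for u = t the tail is 0, while the ramps converge to another value. *)
Lemma measurable_tail :
  measurable_fun (D `*` D) (fun p => (p.2 <= p.1)%R%:R * tail p.1 (p.2 - p.1)).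
Proof.
pose lc t := l (clamp 0 T t).
have clc : continuous lc by apply: continuous_clamp => //; exact: ltW.
pose f m t u := lc t (C0one r) - lc t (C0ramp r m (u - t)).
have mfm m : measurable_fun setT (fun p : R * R => f m p.1 p.2).
  apply: measurable_caratheodory => [u t|t].
    apply: cvgB; first by apply: cvg_dual_eval; [exact: clc|exact: cvg_cst].
    apply: cvg_dual_eval; first exact: clc.
    apply: (@continuous_comp _ _ _ (fun t => u - t) (C0ramp r m)).
      by apply: cvgB; [exact: cvg_cst|exact: cvg_id].
    exact: C0ramp_continuous.
  apply: continuous_measurable_fun => u.
  apply: cvgB; first exact: cvg_cst.
  apply: cvg_dual_eval; first exact: cvg_cst.
  apply: (@continuous_comp _ _ _ (fun u => u - t) (C0ramp r m)).
    by apply: cvgB; [exact: cvg_id|exact: cvg_cst].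
  exact: C0ramp_continuous.
pose A : set (R * R) := [set p | (p.2 < p.1)%R].
have mA : measurable A.
  have mh : measurable_fun setT (fun p : R * R => p.1 - p.2).
    by apply: measurable_funB.
  have := mh measurableT _ (measurable_itv `]0, +oo[).
  rewrite setTI (_ : _ @^-1` _ = A)//; apply/seteqP; split=> p /=;
    by rewrite in_itv/= andbT subr_gt0.
apply: (@measurable_fun_cvg _ _ _ _
  (fun m p => \1_A p * f m p.1 p.2)).
  move=> m; apply: measurable_funTS; apply: measurable_funM => //.
move=> [t u] /= [tI uI].
have AE : \1_A (t, u) = (u < t)%R%:R :> R.
  by rewrite indicE (_ : ((t, u) \in A) = (u < t)%R)//; apply/idP/idP; rewrite inE.
have [ut|tu] := ltP u t.
  apply: (@cvg_trans _ (f m t u @[m --> \oo])).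
    by apply: near_eq_cvg; near=> m; rewrite AE ut mul1r.
  rewrite (ltW ut) mul1r /f /tail /lc clamp_id//; apply: cvgB; first exact: cvg_cst.
  by apply: riesz1_cvg => //; rewrite subr_lt0.
have -> : (u <= t)%R%:R * tail t (u - t) = 0.
  move: tu; rewrite le_eqVlt => /orP[/eqP ->|tu]; first by rewrite subrr tail0 mulr0.
  by rewrite leNgt tu mul0r.
apply: (@cvg_trans _ (cst 0 @ \oo)); last exact: cvg_cst.
by apply: near_eq_cvg; near=> m; rewrite AE ltNge tu mul0r.
Unshelve. all: by end_near. Qed.

Lemma measurable_tail_kernel (w : R -> R) : continuous w ->
  measurable_fun (D `*` D)
    (fun p => (p.2 <= p.1)%R%:R * (w p.2 * tail p.1 (p.2 - p.1))).
Proof.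
move=> cw; rewrite (_ : (fun p : R * R => _) =
  (fun p : R * R => w p.2 * ((p.2 <= p.1)%R%:R * tail p.1 (p.2 - p.1)))).
  apply: measurable_funM; last exact: measurable_tail.
  apply: measurable_funTS; apply: measurableT_comp => //.
  exact: continuous_measurable_fun.
by apply/funext => p; rewrite mulrCA.
Qed.

Let mD : measurable D. Proof. exact: measurable_itv. Qed.

Let bool1 (b : bool) : `|b%:R : R| <= 1.
Proof. by case: b; rewrite ?normr1 ?normr0. Qed.

(** The total factor that the functionals l t with t >= u give to the value at u of
    the integrated function. *)
Definition advance u : R := \int[lebesgue]_(t in `[u, T]) tail t (u - t).

Lemma measurable_tail_slice u : u \in `[0, T] ->
  measurable_fun `[u, T] (fun t => tail t (u - t)).
Proof.
move=> uI; have := measurable_slice2 (X := R) (Y := R)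
  (f := fun t u : R => (u <= t)%R%:R * tail t (u - t))
  mD mD measurable_tail uI.
move=> /(measurable_funS mD) H.
apply: (@eq_measurable_fun _ _ _ _ _ (fun t => (u <= t)%R%:R * tail t (u - t))).
  by move=> t; rewrite inE/= in_itv/= => /andP[-> _]; rewrite mul1r.
apply: H => t/=; rewrite !in_itv/= => /andP[ut ->].
by move: uI; rewrite in_itv/= => /andP[/le_trans ->].
Qed.

Lemma advance_Fubini (w : R -> R) : continuous w ->
  \int[lebesgue]_(t in `[0, T]) \int[lebesgue]_(u in `[0, t]) (w u * tail t (u - t)) =
  \int[lebesgue]_(u in `[0, T]) (w u * advance u).
Proof.
move=> cw; have [M M0 HM] := tail_bound.
have [W HW] := continuous_bounded_itv 0 T cw.
pose K t u : R := (u <= t)%R%:R * (w u * tail t (u - t)).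
have KM t u : D t -> D u -> `|K t u| <= W * M.
  move=> tI uI; rewrite /K normrM normrM -[W * M]mul1r ler_pM// ler_pM//.
    exact: HW.
  exact: HM.
transitivity (\int[lebesgue]_(t in `[0, T]) \int[lebesgue]_(u in `[0, T]) K t u).
  apply: eq_Rintegral => t; rewrite inE/= in_itv/= => /andP[t0 tT].
  rewrite (_ : `[0, t]%classic = D `&` `]-oo, t]%classic).
    rewrite Rintegral_mkcondr; apply: eq_Rintegral => u _; rewrite patchE /K.
    by rewrite mem_setE in_itv/=; case: ifP => _; rewrite ?mul1r ?mul0r.
  apply/seteqP; split => u/=; rewrite !in_itv/=.
    by move=> /andP[-> ut]; rewrite ut (le_trans ut).
  by case=> /andP[-> _].
rewrite (@bounded_Fubini _ _ _ _ R lebesgue lebesgue _ _ K (W * M) mD mD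
  (lebesgue_itvcc_lty 0 T) (lebesgue_itvcc_lty 0 T) (measurable_tail_kernel cw) KM).
apply: eq_Rintegral => u; rewrite inE/= => uI.
have := uI; rewrite in_itv/= => /andP[u0 uT].
have mu : measurable (`[u, T]%classic : set (measurableTypeR R)).
  exact: measurable_itv.
rewrite /advance -RintegralZl//; last first.
  apply: (@bounded_integrable _ _ _ lebesgue _ mu (lebesgue_itvcc_lty u T) _ M).
    exact: measurable_tail_slice.
  move=> t/=; rewrite in_itv/= => /andP[ut tT]; apply: HM.
  by rewrite in_itv/= tT (le_trans u0).
rewrite [in RHS](_ : `[u, T]%classic = D `&` `[u, +oo[%classic).
  rewrite Rintegral_mkcondr; apply: eq_Rintegral => t _; rewrite patchE /K.
  by rewrite mem_setE in_itv/= andbT; case: ifP => _; rewrite ?mul1r ?mul0r.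
apply/seteqP; split => t/=; rewrite !in_itv/= andbT.
  by move=> /andP[ut ->]; rewrite ut (le_trans u0).
by case=> /andP[_ ->] ->.
Qed.

(** With t replaced by t + d in the second integral, the two integrands are values
    at the same point of the tails of l t and l (t + d). *)
Let advance_increment u d e M : 0 <= u -> 0 <= d -> u + d <= T ->
  (forall t theta, t \in `[0, T] -> `|tail t theta| <= M) ->
  (forall t, t \in `[0, T] -> t + d \in `[0, T] -> `|l t - l (t + d)| <= e) ->
  `|advance u - advance (u + d)| <= 2 * e * T + M * d.
Proof.
move=> u0 d0 udT HM He.
have uI : u \in `[0, T] by rewrite in_itv/= u0 (le_trans _ udT)// lerDl.
have udI : u + d \in `[0, T] by rewrite in_itv/= udT addr_ge0.
have M0 : 0 <= M by rewrite (le_trans _ (HM 0 0 _))// in_itv/= lexx ltW.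
have e0 : 0 <= e by apply: le_trans (He u uI udI).
have E : (T - d) + d = T by rewrite subrK.
have uTd : u <= T - d by rewrite lerBrDr.
have mf := measurable_tail_slice udI.
have fM t : t \in `[u + d, T] -> `|tail t (u + d - t)| <= M.
  rewrite in_itv/= => /andP[h1 h2]; apply: HM.
  by rewrite in_itv/= h2 andbT (le_trans _ h1)// addr_ge0.
have advE : advance (u + d) = \int[lebesgue]_(t in `[u, T - d]) tail (t + d) (u - t).
  rewrite /advance -{1}E (@Rintegral_translation _ _ _ _ _ M) ?E//.
  by apply: eq_Rintegral => t _; congr (tail _ _); ring.
have mI : measurable (`[u, T - d]%classic : set (measurableTypeR R)).
  exact: measurable_itv.
have mJ : measurable (`]T - d, T]%classic : set (measurableTypeR R)).
  exact: measurable_itv.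
have muT : measurable (`[u, T]%classic : set (measurableTypeR R)).
  exact: measurable_itv.
have sub1 : `[u, T - d]%classic `<=` `[u, T]%classic.
  by move=> t/=; rewrite !in_itv/= => /andP[-> h]; rewrite (le_trans h)// gerBl.
have sub2 : `]T - d, T]%classic `<=` `[u, T]%classic.
  by move=> t/=; rewrite !in_itv/= => /andP[h ->]; rewrite (le_trans uTd)// ltW.
have inT t : t \in `[u, T] -> t \in `[0, T].
  by rewrite !in_itv/= => /andP[h ->]; rewrite (le_trans u0).
have i1 : lebesgue.-integrable `[u, T] (EFin \o (fun t => tail t (u - t))).
  apply: (@bounded_integrable _ _ _ lebesgue _ muT (lebesgue_itvcc_lty u T) _ M).
    exact: measurable_tail_slice.
  by move=> t tI; exact/HM/inT.
have m1 := measurable_funS muT sub1 (measurable_tail_slice uI).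
have m2 : measurable_fun `[u, T - d] (fun t => tail (t + d) (u - t)).
  rewrite (_ : (fun t => _) = (fun t => tail t (u + d - t)) \o (fun t => t + d));
    last first.
    by apply/funext => t /=; congr (tail _ _); ring.
  apply: (measurable_comp (F := `[u + d, T]%classic)) => //.
    by move=> _ [t /= + <-]; rewrite !in_itv/= lerD2r lerBrDr.
  by apply: measurable_funD.
have i2 : lebesgue.-integrable `[u, T - d] (EFin \o (fun t => tail t (u - t))).
  exact: integrableS i1.
have i3 : lebesgue.-integrable `[u, T - d] (EFin \o (fun t => tail (t + d) (u - t))).
  apply: (@bounded_integrable _ _ _ lebesgue _ mI (lebesgue_itvcc_lty u (T - d)) _
    M) => //.
  move=> t/=; rewrite in_itv/= => /andP[h1 h2]; apply: HM.
  by rewrite in_itv/=; apply/andP; split; lra.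
have split : advance u = \int[lebesgue]_(t in `[u, T - d]) tail t (u - t) +
    \int[lebesgue]_(t in `]T - d, T]) tail t (u - t).
  rewrite -(@Rintegral_itvB _ _ (BLeft u) (BRight T) (T - d)) ?bnd_simp//.
    by rewrite addrC subrK.
  by rewrite gerBl.
rewrite split advE addrAC -RintegralB//.
apply: le_trans (ler_normD _ _) _; apply: lerD.
  apply: (@le_trans _ _ (2 * e * fine (lebesgue `[u, T - d]%classic))).
    apply: (@bounded_Rintegral_le _ _ _ lebesgue _ mI (lebesgue_itvcc_lty u (T - d))).
      exact: measurable_funB.
    move=> t/=; rewrite in_itv/= => /andP[h1 h2].
    apply: le_trans (tail_lip _ _ _) _; rewrite ler_wpM2l//; apply: He.
      by apply: inT; rewrite in_itv/= h1 (le_trans h2)// gerBl.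
    by rewrite in_itv/=; apply/andP; split; lra.
  rewrite ler_wpM2l ?mulr_ge0// lebesgue_measure_itv/= lte_fin.
  by case: ifP => _ /=; lra.
apply: (@le_trans _ _ (M * fine (lebesgue `]T - d, T]%classic))).
  have fin : (lebesgue `](T - d)%R, T]%classic < +oo)%E.
    by rewrite lebesgue_measure_itv/=; case: ifP; rewrite ?ltry// -EFinB ltry.
  apply: (@bounded_Rintegral_le _ _ _ lebesgue _ mJ fin).
    exact: (measurable_funS muT sub2 (measurable_tail_slice uI)).
  by move=> t tJ; apply/HM/inT/sub2.
rewrite ler_wpM2l// lebesgue_measure_itv/= lte_fin.
by case: ifP => _ /=; lra.
Qed.

(** After translating the variable of integration, moving u only changes the
    charge l t in norm, and so the atoms of the charges do no harm. *)
Lemma advance_continuous : {within `[0, T], continuous advance}.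
Proof.
apply/within_continuousP => u uI e e0; have [M M0 HM] := tail_bound.
have e10 : 0 < e / (8 * T) by rewrite divr_gt0// mulr_gt0.
have [d d0 Hd] := uniformly_continuous_segment cl e10.
have M10 : 0 < M + 1 by rewrite ltr_wpDl.
exists (Num.min d (e / 2 / (M + 1))); first by rewrite lt_min d0 !divr_gt0.
have main s t : s \in `[0, T] -> t \in `[0, T] -> s <= t ->
    t - s < d -> t - s < e / 2 / (M + 1) -> `|advance s - advance t| < e.
  rewrite !in_itv/= => /andP[s0 sT] /andP[t0 tT] st std stM.
  have d'0 : 0 <= t - s by rewrite subr_ge0.
  have sE : s + (t - s) = t by rewrite addrC subrK.
  have := @advance_increment s (t - s) (e / (8 * T)) M s0 d'0.
  rewrite sE => /(_ tT HM) H; apply: le_lt_trans (H _) _.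
    move=> a aI adI; rewrite ltW// Hd// opprD addNKr normrN ger0_norm//.
  have -> : 2 * (e / (8 * T)) * T = e / 4.
    by field; rewrite gt_eqF.
  have : (M + 1) * (t - s) < e / 2 by rewrite mulrC -ltr_pdivlMr.
  by rewrite mulrDl mul1r; lra.
move=> t tI; rewrite lt_min => /andP[h1 h2].
have [ut|tu] := leP u t.
  by apply: main => //; move: h1 h2; rewrite distrC ger0_norm ?subr_ge0.
rewrite distrC; apply: main => //; first exact: ltW.
  by move: h1; rewrite ger0_norm ?subr_ge0// ltW.
by move: h2; rewrite ger0_norm ?subr_ge0// ltW.
Qed.

Lemma mass_continuous : {within `[0, T], continuous mass}.
Proof.
apply: within_continuous_eval => //.
by apply: continuous_subspaceT => s; exact: cvg_cst.
Qed.

(** riesz1 vanishes to the left of - r, which is why the upper bound of the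
    integral can be moved to T. *)
Lemma riesz1_integral u : u \in `[0, T] ->
  \int[lebesgue]_(t in `[u, Num.min (u + r) T]) riesz1 (l t) (u - t) =
  primitive (mass \o clamp 0 T) T - primitive (mass \o clamp 0 T) u - advance u.
Proof.
move=> uI; have := uI; rewrite in_itv/= => /andP[u0 uT].
have [M M0 HM] := tail_bound.
have muT : measurable (`[u, T]%classic : set (measurableTypeR R)).
  exact: measurable_itv.
have sub : `[u, T]%classic `<=` `[0, T]%classic.
  by move=> t/=; rewrite !in_itv/= => /andP[h ->]; rewrite (le_trans u0).
have i1 : lebesgue.-integrable `[u, T] (EFin \o (fun t => tail t (u - t))).
  apply: (@bounded_integrable _ _ _ lebesgue _ muT (lebesgue_itvcc_lty u T) _ M).
    exact: measurable_tail_slice.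
  by move=> t tI; exact/HM/sub.
have i2 : lebesgue.-integrable `[u, T] (EFin \o mass).
  by apply: integrableS (within_continuous_integrable mass_continuous).
have cm : continuous (mass \o clamp 0 T).
  by apply: continuous_clamp; [exact: ltW|exact: mass_continuous].
transitivity (\int[lebesgue]_(t in `[u, T]) (mass t - tail t (u - t))).
  rewrite (_ : `[u, Num.min (u + r) T]%classic =
      `[u, T]%classic `&` `]-oo, u + r]%classic).
    rewrite Rintegral_mkcondr; apply: eq_Rintegral => t _; rewrite patchE.
    rewrite mem_setE in_itv/= /tail subKr; case: leP => // h.
    by rewrite riesz1_out// in_itv/=; apply/negP => /andP[? _]; lra.
  apply/seteqP; split => t/=; rewrite !in_itv/= le_min.
    by move=> /and3P[-> -> ->].
  by case=> /andP[-> ->] ->.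
rewrite RintegralB//; congr (_ - _).
rewrite /primitive (@Rintegral_itvB _ _ (BLeft 0) (BRight T) u) ?bnd_simp//; last first.
  exact: continuous_itv_integrable.
rewrite Rintegral_itv_obnd_cbnd; last first.
  apply: integrableS (continuous_itv_integrable u T cm) => //.
  by move=> t/=; rewrite !in_itv/= => /andP[/ltW -> ->].
by apply: eq_Rintegral => t; rewrite inE => /sub tI; rewrite /= clamp_id.
Qed.

End memory_kernel.

Section du_Bois_Reymond.
Context {R : realType} (T : R).
Hypothesis T0 : 0 < T.
Local Notation lebesgue := (@lebesgue_measure R).

(** The primitive of v is nondecreasing from 0 to 0, so its derivative v is 0. *)
Lemma continuous_ge0_integral_eq0 (v : R -> R) : continuous v ->
  (forall u, 0 <= v u) -> primitive v T = 0 -> forall t, t \in `[0, T] -> v t = 0.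
Proof.
move=> cv v0 PT t tI.
have P0 s : s \in `[0, T] -> primitive v s = 0.
  rewrite in_itv/= => /andP[s0 sT]; apply/eqP; rewrite eq_le; apply/andP; split.
    rewrite -PT -subr_ge0 /primitive.
    rewrite (@Rintegral_itvB _ _ (BLeft 0) (BRight T) s) ?bnd_simp//.
      by apply: Rintegral_ge0.
    exact: continuous_itv_integrable.
  exact: Rintegral_ge0.
have [_ <-] := deriv_onP T0 tI (primitive_diff_quotient cv tI).
suff H : diff_quotient_on 0 T (primitive v) t --> (0 : R).
  by have [_ ->] := deriv_onP T0 tI H.
apply/diff_quotientP => e e0; exists 1 => // s sI _ _.
by rewrite !P0// subrr scaler0 subrr normr0.
Qed.

(** Testing against f minus its mean value gives the integral of the square of
    that difference. *)
Lemma du_Bois_Reymond (f : R -> R) : {within `[0, T], continuous f} ->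
  (forall w, continuous w -> primitive w T = 0 ->
     \int[lebesgue]_(u in `[0, T]) (w u * f u) = 0) ->
  exists c, forall u, u \in `[0, T] -> f u = c.
Proof.
move=> cf Hf; pose fc := f \o clamp 0 T.
have cfc : continuous fc by apply: continuous_clamp => //; exact: ltW.
pose c := primitive fc T / T; exists c.
pose w u := fc u - c.
have cw : continuous w by move=> u; apply: cvgB; [exact: cfc|exact: cvg_cst].
have m0T : measurable (`[0, T]%classic : set (measurableTypeR R)).
  exact: measurable_itv.
have lT : fine (lebesgue `[0, T]%classic) = T.
  by rewrite lebesgue_measure_itv/= lte_fin T0 /= subr0.
have cint k : lebesgue.-integrable `[0, T] (EFin \o cst k).
  by apply: continuous_itv_integrable; exact: cst_continuous.
have Pw : primitive w T = 0.
  rewrite /primitive RintegralB//; [|exact: continuous_itv_integrable|exact: cint].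
  by rewrite Rintegral_cst// lT /c divfK ?gt_eqF// subrr.
have cww : continuous (fun u => w u * w u) by move=> u; apply: cvgM; exact: cw.
have cwc : continuous (fun u => w u * c).
  by move=> u; apply: cvgM; [exact: cw|exact: cvg_cst].
have Pww : primitive (fun u => w u * w u) T = 0.
  transitivity (\int[lebesgue]_(u in `[0, T]) (w u * fc u - w u * c)).
    by apply: eq_Rintegral => u _; rewrite /w; ring.
  rewrite RintegralB//; last 2 first.
  - apply: continuous_itv_integrable => u.
    by apply: cvgM; [exact: cw|exact: cfc].
  - exact: continuous_itv_integrable.
  rewrite RintegralZr//; last exact: continuous_itv_integrable.
  rewrite [X in _ - X * c](_ : _ = 0) ?mul0r ?subr0; last exact: Pw.
  rewrite -[RHS](Hf w cw Pw); apply: eq_Rintegral => u; rewrite inE => uI.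
  by rewrite /fc/= clamp_id.
move=> u uI; have := continuous_ge0_integral_eq0 cww (fun v => sqr_ge0 (w v)) Pww uI.
by move/eqP; rewrite mulf_eq0 orbb /w /fc/= clamp_id// subr_eq0 => /eqP.
Qed.

End du_Bois_Reymond.

(** * The Euler-Lagrange equation *)

Section Euler_Lagrange.
Context {R : realType} (n : nat) (r T : R).
Hypotheses (r0 : 0 < r) (rT : r < T).
Local Notation V := 'rV[R]_n.
Local Notation H := (C0 (- r) 0 V).
Local Notation Z := (C0 (- r) T V).
Local Notation lebesgue := (@lebesgue_measure R).
Variable F : R -> H -> V -> R.
Hypotheses (F1 : A1 T F) (F2 : A2 T F) (F3 : A3 T F).
Variables (psi : H) (zeta : V) (x : Z).
Hypothesis xsol : local_solution F psi zeta x.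
Variable k : 'I_n.

Let T0 : 0 < T. Proof. exact: lt_trans rT. Qed.

Local Notation e_k := (basis_vec k : V).

Definition coordinate_along t : dual (C0 (- r) 0 R) := coordinate k (D2_along F x t).

Lemma coordinate_along_continuous : {within `[0, T], continuous coordinate_along}.
Proof. exact/coordinate_continuous/(D2_along_continuous F2 xsol). Qed.

Section test_direction.
Variable w : R -> R.
Hypotheses (cw : continuous w) (wT : primitive w T = 0).

Let h : Z := toC0 (- r) T (fun t => primitive w t *: e_k).

Let hE t : t \in `[- r, T] -> h t = primitive w t *: e_k.
Proof.
move=> tI; rewrite toC0E//.
apply: (within_continuous_le (C := `|e_k|)
  (@primitive_within_continuous _ w cw (- r) T)) => u v _ _.
by rewrite -scalerBl normrZ mulrC.
Qed.

Let inZ t : t \in `[0, T] -> t \in `[- r, T].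
Proof.
rewrite !in_itv/= => /andP[t_ge0 ->]; rewrite andbT (le_trans _ t_ge0)//.
by rewrite oppr_le0 ltW.
Qed.

Let h_deriv t : t \in `[0, T] ->
  derivable_on 0 T h t /\ deriv_on 0 T h t = w t *: e_k.
Proof.
move=> tI; apply: deriv_onP => //; apply/diff_quotientP => e e0.
have c0 : 0 < `|e_k| + 1 by rewrite ltr_wpDl.
have /diff_quotientP/(_ (e / (`|e_k| + 1))) := primitive_diff_quotient cw tI.
move=> [|d d0 Hd]; first by rewrite divr_gt0.
exists d => // s sI st std; rewrite !hE ?inZ// -scalerBl scalerA -scalerBl normrZ.
apply: (@le_lt_trans _ _ (`|w t - (s - t)^-1 * (primitive w s - primitive w t)| *
  (`|e_k| + 1))); first by rewrite ler_wpM2l// lerDl.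
by rewrite -ltr_pdivlMr//; exact: Hd.
Qed.

Let h_C1 : C1_on 0 T h.
Proof.
split=> [t /h_deriv[]//|].
apply: (@within_continuous_eq _ _ _ _ (fun t => w t *: e_k)).
  by move=> t /h_deriv[_ ->].
apply: (within_continuous_le (C := `|e_k|) (continuous_subspaceT cw)) => u v _ _.
by rewrite -scalerBl normrZ mulrC.
Qed.

Let h_history t : t \in `[0, T] ->
  D2_along F x t (history h t) =
  \int[lebesgue]_(u in `[0, t]) (w u * tail coordinate_along t (u - t)).
Proof.
move=> tI; have := tI; rewrite in_itv/= => /andP[t0 tT].
pose phi : C0 (- r) 0 R := toC0 (- r) 0 (fun theta => primitive w (t + theta)).
have phiE theta : theta \in `[- r, 0] -> phi theta = primitive w (t + theta).
  move=> thI; rewrite toC0E//; apply/within_continuousP => s sI e e0.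
  have /within_continuousP/(_ (t + s)) := @primitive_within_continuous _ w cw (t - r) t.
  have inI v : v \in `[- r, 0] -> t + v \in `[t - r, t].
    by rewrite !in_itv/= lerD2l gerDl.
  move=> /(_ (inI _ sI) e e0)[d d0 Hd]; exists d => // v vI sv.
  by apply: Hd; rewrite ?inI// opprD addrACA subrr add0r.
rewrite -(dual_primitive r0 cw (coordinate_along t) t0 phiE) coordinateE.
congr (D2_along F x t _); apply: C0P => u uI.
rewrite historyE// C0embedE// phiE// hE//.
by move: tI uI; rewrite !in_itv/= => /andP[? ?] /andP[? ?]; apply/andP; split; lra.
Qed.

Lemma coordinate_variation :
  \int[lebesgue]_(u in `[0, T])
    (w u * (D3_along F x u e_k + advance T coordinate_along u)) = 0.
Proof.
have TI : 0 \in `[0, T] by rewrite in_itv/= lexx ltW.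
have h0 : history h 0 = 0.
  apply: C0P => u uI; rewrite historyE// add0r C00.
  have := uI; rewrite in_itv/= => /andP[ru u0].
  by rewrite hE ?primitive_le0 ?scale0r// in_itv/= ru (le_trans u0)// ltW.
have hT : h T = 0.
  by rewrite hE ?wT ?scale0r// inZ// in_itv/= lexx ltW.
have := first_variation r0 rT F1 F2 F3 xsol h_C1 h0 hT.
have m0T : measurable (`[0, T]%classic : set (measurableTypeR R)).
  exact: measurable_itv.
have cp : {within `[0, T], continuous (fun t => D3_along F x t e_k : R)}.
  apply: within_continuous_eval; first exact: (D3_along_continuous F3 xsol).
  by apply: continuous_subspaceT => s; exact: cvg_cst.
have cwp : {within `[0, T], continuous (fun t => w t * D3_along F x t e_k)}.
  move=> t; apply: cvgM; last exact: (cp t).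
  exact: (continuous_subspaceT cw).
have cL : {within `[0, T], continuous (fun t => D2_along F x t (history h t) : R)}.
  apply: within_continuous_eval; first exact: (D2_along_continuous F2 xsol).
  exact: history_continuous.
have cwa : {within `[0, T], continuous (fun t => w t * advance T coordinate_along t)}.
  move=> t; apply: cvgM; first exact: (continuous_subspaceT cw).
  exact: (advance_continuous r0 T0 coordinate_along_continuous).
move=> var0; apply: (etrans _ var0).
transitivity (\int[lebesgue]_(t in `[0, T])
  (w t * D3_along F x t e_k + w t * advance T coordinate_along t)).
  by apply: eq_Rintegral => t _; rewrite mulrDr.
rewrite RintegralD//; try exact: within_continuous_integrable.
transitivity (\int[lebesgue]_(t in `[0, T])
  (D2_along F x t (history h t) + w t * D3_along F x t e_k)); last first.
  apply: eq_Rintegral => t; rewrite inE => tI.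
  by rewrite /variation (h_deriv tI).2 dual_argZ.
rewrite RintegralD//; try exact: within_continuous_integrable.
rewrite addrC; congr (_ + _).
rewrite -(advance_Fubini r0 T0 coordinate_along_continuous cw).
by apply: eq_Rintegral => t; rewrite inE => tI; rewrite h_history.
Qed.

End test_direction.

Lemma D3_advance_constant : exists c, forall u, u \in `[0, T] ->
  D3_along F x u e_k + advance T coordinate_along u = c.
Proof.
apply: du_Bois_Reymond => //; last by move=> w cw wT; exact: coordinate_variation.
have cp : {within `[0, T], continuous (fun t => D3_along F x t e_k : R)}.
  apply: within_continuous_eval; first exact: (D3_along_continuous F3 xsol).
  by apply: continuous_subspaceT => s; exact: cvg_cst.
move=> t; apply: cvgD; first exact: (cp t).
exact: (advance_continuous r0 T0 coordinate_along_continuous).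
Qed.

(** The coordinate of q is a constant plus a primitive of the total mass of the
    charges, which is riesz1 at 0. *)
Lemma Euler_Lagrange_coordinate : exists c, forall u, u \in `[0, T] ->
  D3_along F x u e_k -
    \int[lebesgue]_(t in `[u, Num.min (u + r) T]) riesz1 (coordinate_along t) (u - t) =
  c + primitive (mass coordinate_along \o clamp 0 T) u.
Proof.
have [c Hc] := D3_advance_constant.
exists (c - primitive (mass coordinate_along \o clamp 0 T) T) => u uI.
by rewrite (riesz1_integral r0 T0 coordinate_along_continuous uI) -(Hc u uI); ring.
Qed.

End Euler_Lagrange.

Section finite_sums.
Context {R : realType} {W : normedModType R} (a b : R) (I : Type).
Variables (f : I -> R -> R) (v : I -> W).

Lemma diff_quotient_sum (l : I -> R) (s : seq I) t :
  (forall i, diff_quotient_on a b (f i) t --> l i) ->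
  diff_quotient_on a b (fun u => \sum_(i <- s) f i u *: v i) t -->
    \sum_(i <- s) l i *: v i.
Proof.
move=> fl.
have H : \sum_(i <- s) ((u - t)^-1 * (f i u - f i t)) *: v i
    @[u --> within `[a, b] t^'] --> \sum_(i <- s) l i *: v i.
  apply: cvg_big => [|i _]; first exact: add_continuous.
  by apply: cvgZ; [exact: fl|exact: cvg_cst].
rewrite /diff_quotient_on [X in X @ _ --> _](_ : _ = fun u =>
  \sum_(i <- s) ((u - t)^-1 * (f i u - f i t)) *: v i)//.
apply/funext => u; rewrite -sumrB scaler_sumr; apply: eq_bigr => i _.
by rewrite -scalerBl scalerA.
Qed.

Lemma within_continuous_sum (s : seq I) :
  (forall i, {within `[a, b], continuous (f i)}) ->
  {within `[a, b], continuous (fun u => \sum_(i <- s) f i u *: v i)}.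
Proof.
move=> cf; elim: s => [|i s IH].
  apply: (@within_continuous_eq _ _ _ _ (cst 0)) => [t _|]; first by rewrite big_nil.
  by apply: continuous_subspaceT => t; exact: cvg_cst.
apply: (@within_continuous_eq _ _ _ _
  (fun u => f i u *: v i + 1 *: \sum_(j <- s) f j u *: v j)) => [t _|].
  by rewrite big_cons scale1r.
apply: within_continuous_lin => //.
apply: (within_continuous_le (C := `|v i|) (cf i)) => t u _ _.
by rewrite -scalerBl normrZ mulrC.
Qed.

End finite_sums.

Unset Implicit Arguments.

Theorem theorem3p1 (R : realType) (n : nat) (r T : R)
    (psi : C0 (- r) 0 'rV[R]_n) (zeta : 'rV[R]_n)
    (F : R -> C0 (- r) 0 'rV[R]_n -> 'rV[R]_n -> R)
    (x : C0 (- r) T 'rV[R]_n) :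
  (1 <= n)%N -> 0 < r -> r < T ->
  A1 T F -> A2 T F -> A3 T F ->
  local_solution F psi zeta x ->
  let x' := deriv_on 0 T x in
  let q := fun t : R =>
    D3 F t (history x t) (x' t) -
    dual_integral `[t, Num.min (t + r) T]
      (fun s => rieszn (D2 F s (history x s) (x' s)) (t - s)) in
  C1_on 0 T q /\
  (forall t, t \in `[0, T] ->
     deriv_on 0 T q t = rieszn (D2 F t (history x t) (x' t)) 0).
Proof.
move=> _ r0 rT F1 F2 F3 xsol x' q.
have T0 : 0 < T := lt_trans r0 rT.
pose m k := mass (coordinate_along F x k).
have /choice[c Hc] : forall k : 'I_n, exists c, forall u, u \in `[0, T] ->
    D3_along F x u (basis_vec k) - \int[lebesgue_measure]_(t in `[u, Num.min (u + r) T])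
      riesz1 (coordinate_along F x k t) (u - t) = c + primitive (m k \o clamp 0 T) u.
  by move=> k; exact: (Euler_Lagrange_coordinate r0 rT F1 F2 F3 xsol k).
have qE t : t \in `[0, T] ->
    q t = \sum_(k < n) (c k + primitive (m k \o clamp 0 T) t) *: dual_basis_vec k.
  move=> tI; rewrite /q [D3 _ _ _ _]dual_basis_expansion /dual_integral -sumrB.
  apply: eq_bigr => k _; rewrite -scalerBl -Hc//; congr ((_ - _) *: _).
  by apply: eq_Rintegral => s _; rewrite rieszn_basis.
have mc k : {within `[0, T], continuous (m k)}.
  exact: (mass_continuous (coordinate_along_continuous (k := k) F2 xsol)).
have cm k : continuous (m k \o clamp 0 T).
  by apply: continuous_clamp => //; exact: ltW.
have qd t : t \in `[0, T] -> derivable_on 0 T q t /\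
    deriv_on 0 T q t = \sum_(k < n) m k t *: dual_basis_vec k.
  move=> tI; apply: deriv_onP => //.
  have H : diff_quotient_on 0 T (fun u => \sum_(k < n)
      (c k + primitive (m k \o clamp 0 T) u) *: dual_basis_vec k) t -->
      \sum_(k < n) m k t *: dual_basis_vec k.
    apply: diff_quotient_sum => k.
    apply/diff_quotientP => e e0.
    have /diff_quotientP/(_ e e0)[d d0 Hd] := primitive_diff_quotient (cm k) tI.
    exists d => // s sI st std; rewrite opprD addrACA subrr add0r.
    by have := Hd s sI st std; rewrite /= clamp_id.
  apply/diff_quotientP => e e0; have /diff_quotientP/(_ e e0)[d d0 Hd] := H.
  by exists d => // s sI st std; rewrite !qE//; exact: Hd.
split; last first.
  move=> t tI; rewrite (qd t tI).2 /rieszn; apply: eq_bigr => k _.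
  by rewrite -/(coordinate k _) riesz1_0.
split=> [t /qd[]//|].
apply: (@within_continuous_eq _ _ _ _
  (fun t => \sum_(k < n) m k t *: dual_basis_vec k)).
  by move=> t tI; rewrite (qd t tI).2.
exact: (@within_continuous_sum _ (dual 'rV[R]_n) _ _ _ m
  (fun k => dual_basis_vec k) _ mc).
Qed.
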